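(* Let $\mathcal{A}$ be a unital $C^*$-algebra, let $M, N$ be Hilbert $\mathcal{A}$-modules, and let $F \in B^a(M,N)$. Then $F \in \mathcal{M}\Phi_+(M,N)$ if and only if there exists a closed, orthogonally complementable submodule $M' \subseteq M$ such that $F|_{M'}$ is bounded below and $M'^{\perp}$ is finitely generated.
   Context: $B^a(M,N)$ is the set of bounded adjointable $\mathcal{A}$-linear operators from $M$ to $N$. A closed submodule $M' \subseteq M$ is orthogonally complementable if $M = M' \oplus M'^{\perp}$. An operator $T$ is bounded below if there is $c>0$ with $\|Tx\| \ge c\|x\|$ for all $x$. $\tilde\oplus$ denotes a direct sum of closed submodules that is not necessarily orthogonal. A Hilbert module is finitely generated if it is the (algebraic) $\mathcal{A}$-linear span of a finite set. An isomorphism of Hilbert modules is a bounded $\mathcal{A}$-linear bijection (with bounded inverse). $F \in B^a(M,N)$ belongs to $\mathcal{M}\Phi_+(M,N)$ (upper semi-$\mathcal{A}$-Fredholm) if there are closed submodules $M_1, N_1$ of $M$ and $M_2, N_2$ of $N$ with $M = M_1 \tilde\oplus N_1$, $N = M_2 \tilde\oplus N_2$, $F(M_1) \subseteq M_2$, $F(N_1) \subseteq N_2$, $F|_{M_1}: M_1 \to M_2$ an isomorphism and $N_1$ finitely generated. *)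

(* Defs.v *)
From HB Require Import structures.
From mathcomp Require Import all_boot all_order all_algebra.
From mathcomp Require Import all_classical all_reals all_analysis.
From mathcomp Require Import complex.

Set Implicit Arguments.
Unset Strict Implicit.
Unset Printing Implicit Defensive.

Import Order.TTheory GRing.Theory Num.Theory.
Import numFieldNormedType.Exports.

Local Open Scope classical_set_scope.
Local Open Scope ring_scope.

(* Norms take values in R[i], where 0 <= z and 0 < z entail that z is real.
   The ring structure is bundled here and exported as an instance below:
   declaring the join of PzRing and CompleteNormedModule is rejected by
   Hierarchy Builder, as Num.NumDomain already inherits from a ring and a
   norm.  One is not required to differ from zero. *)
HB.mixin Record isCstarAlgebra (R : realType) A
    of CompleteNormedModule R[i] A := {
  cmul : A -> A -> A ;
  cone : A ;
  cmulA : associative cmul ;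
  cmul1l : left_id cone cmul ;
  cmul1r : right_id cone cmul ;
  cmulDl : left_distributive cmul +%R ;
  cmulDr : right_distributive cmul +%R ;
  cscalerAl : forall (k : R[i]) (a b : A), k *: cmul a b = cmul (k *: a) b ;
  cscalerAr : forall (k : R[i]) (a b : A), k *: cmul a b = cmul a (k *: b) ;
  cnormM : forall a b : A, `|cmul a b| <= `|a| * `|b| ;
  star : A -> A ;
  starK : involutive star ;
  starD : {morph star : a b / a + b} ;
  starZ : forall (k : R[i]) (a : A), star (k *: a) = k^* *: star a ;
  starM : forall a b : A, star (cmul a b) = cmul (star b) (star a) ;
  cstar_norm : forall a : A, `|cmul (star a) a| = `|a| ^+ 2
}.

#[short(type="cstarAlgType")]
HB.structure Definition CstarAlgebra (R : realType) :=
  {A of isCstarAlgebra R A & CompleteNormedModule R[i] A}.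

HB.instance Definition _ (R : realType) (A : cstarAlgType R) :=
  GRing.Zmodule_isPzRing.Build (CstarAlgebra.sort A)
    cmulA cmul1l cmul1r cmulDl cmulDr.

Section Positive.
Context {R : realType} {A : cstarAlgType R}.

Definition invertible (a : A) := exists b : A, a * b = 1 /\ b * a = 1.

Definition spectrum (a : A) : set R[i] :=
  [set l | ~ invertible (l *: (1 : A) - a)].

Definition cstar_pos (a : A) :=
  star a = a /\ forall l, spectrum a l -> 0 <= l.

End Positive.

(* ract x a is the right action x a.  The complex scalar k acts on M as
   k *: 1 : A. *)
HB.mixin Record isHilbertModule (R : realType) (A : cstarAlgType R) M
    of PseudoMetricNormedZmod R[i] M := {
  ract : M -> A -> M ;
  ract1 : forall x, ract x 1 = x ;
  ractM : forall x a b, ract x (a * b) = ract (ract x a) b ;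
  ractDl : forall x y a, ract (x + y) a = ract x a + ract y a ;
  ractDr : forall x a b, ract x (a + b) = ract x a + ract x b ;
  inner : M -> M -> A ;
  innerDr : forall x y z, inner x (y + z) = inner x y + inner x z ;
  innerMr : forall x y a, inner x (ract y a) = inner x y * a ;
  innerC : forall x y, inner y x = star (inner x y) ;
  inner_pos : forall x, cstar_pos (inner x x) ;
  inner_def : forall x, inner x x = 0 -> x = 0 ;
  hilbert_norm : forall x, `|x| ^+ 2 = `|inner x x| ;
  hilbert_complete : forall F : set_system M,
    ProperFilter F -> cauchy F -> cvg F
}.

#[short(type="hilbertModType")]
HB.structure Definition HilbertModule (R : realType) (A : cstarAlgType R) :=
  {M of isHilbertModule R A M & PseudoMetricNormedZmod R[i] M}.

HB.instance Definition _ (R : realType) (A : cstarAlgType R)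
    (M : hilbertModType A) :=
  Uniform_isComplete.Build (HilbertModule.sort M) hilbert_complete.

(* A right A-module is a left module over the converse ring A^c, so that
   {linear M -> N} and submod_closed apply to Hilbert modules. *)
Section RightModule.
Context (R : realType) (A : cstarAlgType R) (M : hilbertModType A).

Let rscale (a : A^c) (x : M) : M := ract x (a : A).

Let rscaleA a b x : rscale a (rscale b x) = rscale (a * b) x.
Proof. by rewrite /rscale -ractM. Qed.

Let rscale1 : left_id 1 rscale.
Proof. exact: ract1. Qed.

Let rscaleDr : right_distributive rscale +%R.
Proof. by move=> a x y; exact: ractDl. Qed.

Let rscaleDl x : {morph rscale^~ x : a b / a + b}.
Proof. by move=> a b; exact: ractDr. Qed.

HB.instance Definition _ :=
  GRing.Zmodule_isLmodule.Build A^c (HilbertModule.sort M)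
    rscaleA rscale1 rscaleDr rscaleDl.

End RightModule.

Section Submodules.
Context {R : realType} {A : cstarAlgType R} {M : hilbertModType A}.
Implicit Types S T : set M.

Definition closed_submodule S := submod_closed [in S] /\ closed S.

Definition orthocomp S : set M :=
  [set x | forall y, S y -> inner y x = 0].

Definition direct_sum S T :=
  (forall x, exists y z, [/\ S y, T z & x = y + z]) /\ S `&` T = [set 0].

Definition orthogonally_complementable S := direct_sum S (orthocomp S).

Definition finitely_generated S :=
  exists (n : nat) (g : 'I_n -> M),
    S = [set x | exists a : 'I_n -> A, x = \sum_(i < n) ract (g i) (a i)].

End Submodules.

Section Operators.
Context {R : realType} {A : cstarAlgType R} {M N : hilbertModType A}.

Definition bounded_on (S : set M) (F : M -> N) :=
  exists c : R[i], 0 < c /\ forall x, S x -> `|F x| <= c * `|x|.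

Definition bounded_below_on (S : set M) (F : M -> N) :=
  exists c : R[i], 0 < c /\ forall x, S x -> c * `|x| <= `|F x|.

Definition adjointable (F : M -> N) :=
  exists G : N -> M, forall x y, inner (F x) y = inner x (G y).

Definition bounded_adjointable (F : {linear M -> N}) :=
  bounded_on setT F /\ adjointable F.

End Operators.

Section Fredholm.
Context {R : realType} {A : cstarAlgType R} {M N : hilbertModType A}.

Definition restricts_to_iso (F : {linear M -> N}) (S : set M) (T : set N) :=
  [/\ set_bij S T F, bounded_on S F &
      exists2 G : N -> M, bounded_on T G & forall x, S x -> G (F x) = x].

Definition upper_semi_Fredholm (F : {linear M -> N}) :=
  bounded_adjointable F /\
  exists (M1 N1 : set M) (M2 N2 : set N),
    [/\ closed_submodule M1 /\ closed_submodule N1,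
        closed_submodule M2 /\ closed_submodule N2,
        direct_sum M1 N1 /\ direct_sum M2 N2,
        F @` M1 `<=` M2 /\ F @` N1 `<=` N2 &
        restricts_to_iso F M1 M2 /\ finitely_generated N1].

End Fredholm.

(* Main.v *)
Require Import Defs.
From mathcomp Require Import all_boot all_order all_algebra.
From mathcomp Require Import all_classical all_reals all_analysis.
From mathcomp Require Import complex lra ring.

Set Implicit Arguments.
Unset Strict Implicit.
Unset Printing Implicit Defensive.

Import Order.TTheory GRing.Theory Num.Theory.
Import numFieldNormedType.Exports.

Local Open Scope classical_set_scope.
Local Open Scope complex_scope.
Local Open Scope ring_scope.

(** The theorem rests on two complementation results for a Hilbert module M.

    [range_complement]: if F is adjointable and bounded below on an orthogonally
    complementable closed submodule S, then F(S) is orthogonally complementable.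
    With P the projection onto S and F^* the adjoint, the operator L = P F^* F
    satisfies <x, L x> = <F x, F x> on S; once L maps S onto S, each n has
    P F^* n = L x for some x in S, which says that n - F x is orthogonal to F(S).

    [finitely_generated_complementable]: a closed submodule S generated by
    g_1, ..., g_n is orthogonally complementable.  With the rank one operators
    theta_i x = g_i <g_i, x>, put L = sum_i theta_i ^ 2.  Again L maps S onto S,
    so for each x there is y in S with L (x - y) = 0; then
    0 = <z, L z> = sum_i <theta_i z, theta_i z> for z = x - y, hence z is
    orthogonal to every g_i.  The theta_i are squared so that <x, L x> is a sum of
    inner squares <w, w>, which are positive by the axioms of a Hilbert module.

    In both cases the surjectivity of L is [coercive_onto], the method of
    continuity: <x, L x> dominates a positive element of norm at least
    e |x| ^ 2, so L + t is bounded below on S uniformly in t >= 0; it is onto for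
    large t, and surjectivity propagates down to t = 0 by perturbation.  Uniformity
    in t needs |a| <= |a + b| for positive a and b ([rnorm_le_add]).  Positivity
    being defined by the spectrum, this in turn requires a spectral value of
    modulus |c| for every self-adjoint c ([selfadj_spectrum_norm]), which is proved
    by averaging resolvents over roots of unity.
    The coercivity for the theta_i comes from the open mapping theorem applied to
    (a_i) |-> sum_i g_i a_i.

    If F is upper semi-Fredholm with decompositions (M1, N1) and (M2, N2), take for
    M' the orthogonal complement of N1.  An x in M' splits as u + v with u in M1
    and v in N1; orthogonality to v gives |x| <= |u|, while F is bounded below on
    M1 and the projection of N onto M2 is bounded, so |u| <= C |F x|.

    Conversely, given M', take M1 = M', M2 = F(M') and N2 the orthogonal
    complement of M2, and let N1 be the preimage of N2.  Subtracting from each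
    generator g_i of the complement of M' the h_i in M' such that F h_i is the
    component of F g_i in M2 yields generators of N1. *)

(** * Real-valued norms and completeness *)

Section RealNorm.
Context {R : realType} {V : normedZmodType R[i]}.
Implicit Types x y z : V.

(** The norms take values in R[i]; their real parts lend themselves to real
    arithmetic. *)
Definition rnorm x : R := complex.Re `|x|.

Lemma rnormE x : `|x| = (rnorm x)%:C.
Proof. by rewrite RRe_real // normr_real. Qed.

Lemma rnorm_ge0 x : 0 <= rnorm x.
Proof. by rewrite -(lecR 0) -rnormE normr_ge0. Qed.

Lemma rnorm0 : rnorm 0 = 0.
Proof. by rewrite /rnorm normr0. Qed.

Lemma rnorm_eq0 x : rnorm x = 0 -> x = 0.
Proof. by move=> x0; apply/eqP; rewrite -normr_eq0 rnormE x0. Qed.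

Lemma rnorm_gt0 x : x <> 0 -> 0 < rnorm x.
Proof. by move=> x0; rewrite lt_def rnorm_ge0 andbT; apply/eqP => /rnorm_eq0. Qed.

Lemma rnormD x y : rnorm (x + y) <= rnorm x + rnorm y.
Proof. by rewrite -lecR rmorphD /= -!rnormE ler_normD. Qed.

Lemma rnormN x : rnorm (- x) = rnorm x.
Proof. by rewrite /rnorm normrN. Qed.

Lemma rnormBC x y : rnorm (x - y) = rnorm (y - x).
Proof. by rewrite -rnormN opprB. Qed.

Lemma rnormB x y : rnorm (x - y) <= rnorm x + rnorm y.
Proof. by rewrite -(rnormN y) rnormD. Qed.

Lemma rnorm_triangle y x z : rnorm (x - z) <= rnorm (x - y) + rnorm (y - z).
Proof. by rewrite (le_trans _ (rnormD _ _)) // addrA subrK. Qed.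

Lemma rnorm_sum (I : Type) (r : seq I) (f : I -> V) :
  rnorm (\sum_(i <- r) f i) <= \sum_(i <- r) rnorm (f i).
Proof.
elim/big_rec2 : _ => [|i u x _ ux]; first by rewrite rnorm0.
by rewrite (le_trans (rnormD _ _)) // lerD2l.
Qed.

End RealNorm.

Lemma rnormM (R : realType) (z w : R[i]) : rnorm (z * w) = rnorm z * rnorm w.
Proof. by apply: complexI; rewrite rmorphM /= -!rnormE normrM. Qed.

Lemma rnorm_real (R : realType) (t : R) : 0 <= t -> rnorm (t%:C) = t.
Proof. by move=> t0; rewrite /rnorm ger0_norm // lecR. Qed.

Lemma exprn_small (R : realType) (q e : R) : 0 <= q -> q < 1 -> 0 < e ->
  exists n, q ^+ n < e.
Proof.
move=> q0 q1 e0.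
have /cvgrPdist_lt/(_ _ e0)[n _ /(_ n (leqnn n))] : (fun k => q ^+ k) @ \oo --> (0 : R).
  by apply: cvg_expr; rewrite ger0_norm.
by rewrite /= sub0r normrN ger0_norm ?exprn_ge0 //; exists n.
Qed.

Lemma geometric_rnorm_eq0 (R : realType) (V : normedZmodType R[i]) (q C : R)
    (x : V) : 0 <= q -> q < 1 -> (forall n, rnorm x <= C * q ^+ n) -> x = 0.
Proof.
move=> q0 q1 xC; apply: contrapT => /rnorm_gt0 x0.
have C0 : 0 < C by rewrite (lt_le_trans x0) // (le_trans (xC 0%N)) // mulr1.
have [n] := exprn_small q0 q1 (divr_gt0 x0 C0).
by rewrite ltr_pdivlMr // mulrC ltNge xC.
Qed.

Section Complete.
Context {R : realType} {T : pseudoMetricNormedZmodType R[i]}.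
Implicit Types (u : nat -> T) (S : set T) (x y : T).

Definition complete_space :=
  forall F : set_system T, ProperFilter F -> cauchy F -> cvg F.

Lemma nbhs_rnorm x (P : set T) : nbhs x P <->
  exists2 e : R, 0 < e & forall y, rnorm (x - y) < e -> P y.
Proof.
split.
  move/nbhs_normP => [e /= e0 eP]; exists (complex.Re e).
    by move: e0; rewrite ltcE => /andP[].
  move=> y xy; apply: eP; rewrite /ball_ /= rnormE.
  by move: e0; rewrite !ltcE /= => /andP[/eqP -> _]; rewrite eqxx.
move=> [e e0 eP]; apply/nbhs_normP; exists e%:C; first by rewrite /= ltcR.
by move=> y /=; rewrite rnormE ltcR; exact: eP.
Qed.

Lemma closed_rnormP S : closed S <->
  forall x, (forall e : R, 0 < e -> exists2 y, S y & rnorm (x - y) < e) -> S x.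
Proof.
split=> cS x.
  move=> xS; apply: cS => B /nbhs_rnorm[e e0 eB].
  by have [y Sy /eB By] := xS _ e0; exists y.
move=> xS; apply: cS => e e0.
have : nbhs x [set y | rnorm (x - y) < e] by apply/nbhs_rnorm; exists e.
by move=> /xS[y [Sy xy]]; exists y.
Qed.

Lemma geometric_limit u (K q : R) : complete_space -> 0 <= q -> q < 1 ->
  (forall k, rnorm (u k.+1 - u k) <= K * q ^+ k) ->
  exists l, forall k, rnorm (l - u k) <= K * q ^+ k / (1 - q).
Proof.
move=> cT q0 q1 uq.
have K0 : 0 <= K by rewrite (le_trans (rnorm_ge0 _) (le_trans (uq 0%N) _)) // mulr1.
have q'0 : 0 < 1 - q by rewrite subr_gt0.
have B0 k : 0 <= K * q ^+ k / (1 - q).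
  by rewrite divr_ge0 ?(ltW q'0) // mulr_ge0 // exprn_ge0.
have uB k n : rnorm (u (k + n)%N - u k) <= K * q ^+ k / (1 - q).
  suff : rnorm (u (k + n)%N - u k) <= K * q ^+ k / (1 - q) * (1 - q ^+ n).
    move=> /le_trans; apply; rewrite ler_piMr // gerBl exprn_ge0 //.
  elim: n => [|n IH]; first by rewrite addn0 subrr rnorm0 expr0 subrr mulr0.
  rewrite (le_trans (rnorm_triangle (u (k + n)%N) _ _)) // addnS.
  rewrite (le_trans (lerD (uq _) IH)) // exprD exprS.
  suff -> : K * (q ^+ k * q ^+ n) + K * q ^+ k / (1 - q) * (1 - q ^+ n) =
     K * q ^+ k / (1 - q) * (1 - q * q ^+ n) by [].
  by field; rewrite gt_eqF.
have Bsmall e : 0 < e -> exists k, K * q ^+ k / (1 - q) < e.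
  move=> e0; have eK : 0 < e * (1 - q) / (K + 1) by rewrite divr_gt0 ?mulr_gt0 // ltr_wpDl.
  have [n qn] := exprn_small q0 q1 eK.
  exists n; rewrite ltr_pdivrMr //.
  rewrite ltr_pdivlMr ?ltr_wpDl // in qn.
  by apply: le_lt_trans qn; rewrite mulrC ler_wpM2l ?exprn_ge0 // lerDl.
have /cT : cauchy (u @ \oo).
  apply/cauchy_ballP => e e0 /=.
  move: (e0); rewrite ltcE => /andP[/eqP ime ree].
  have [k kB] := Bsmall (complex.Re e / 2) (divr_gt0 ree (ltr0Sn _ _)).
  have ball_u n m : (k <= n)%N -> (k <= m)%N -> ball (u n) e (u m).
    move=> kn km; rewrite -ball_normE /ball_ /= rnormE ltcE /= ime eqxx /=.
    rewrite (le_lt_trans (rnorm_triangle (u k) _ _)) // [ltRHS]splitr.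
    rewrite ltrD //; apply: le_lt_trans kB; rewrite 1?[rnorm (u k - _)]rnormBC.
      by rewrite -(subnKC kn).
    by rewrite -(subnKC km).
  rewrite near_map2; near=> n m => /=.
  by apply: ball_u; [near: n|near: m]; exact: nbhs_infty_ge.
move=> cu; exists (lim (u @ \oo)) => k; apply/ler_addgt0Pr => e e0.
have : nbhs (lim (u @ \oo)) [set y | rnorm (lim (u @ \oo) - y) < e].
  by apply/nbhs_rnorm; exists e.
move=> /cu [n _ /(_ (k + n)%N (leq_addl _ _))] /= ln.
rewrite (le_trans (rnorm_triangle (u (k + n)%N) _ _)) //.
by rewrite addrC lerD // ltW.
Unshelve. all: by end_near. Qed.

End Complete.
(** * Inverses in a C*-algebra *)

Section Invertibility.
Context {R : realType} {A : cstarAlgType R}.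
Implicit Types (a b c h u v x y : A) (k l z : R[i]).

Definition inverse_of x u := x * u = 1 /\ u * x = 1.

Lemma cscaleAl k a b : (k *: a) * b = k *: (a * b).
Proof. by rewrite [RHS]cscalerAl. Qed.

Lemma cscaleAr k a b : a * (k *: b) = k *: (a * b).
Proof. by rewrite [RHS]cscalerAr. Qed.

Lemma crnormM a b : rnorm (a * b) <= rnorm a * rnorm b.
Proof. by rewrite -lecR rmorphM /= -!rnormE; exact: cnormM. Qed.

Lemma crnormZ k a : rnorm (k *: a) = rnorm k * rnorm a.
Proof. by apply: complexI; rewrite rmorphM /= -!rnormE normrZ. Qed.

Lemma star1 : star (1 : A) = 1.
Proof.
have := starM (star (1 : A)) 1; rewrite -[cmul _ _]/(star (1 : A) * 1) mulr1 starK.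
by rewrite -[cmul _ _]/(star (1 : A) * 1) mulr1.
Qed.

Lemma cstarM a b : star (a * b) = star b * star a.
Proof. exact: starM. Qed.

Lemma starN a : star (- a) = - star a.
Proof. by rewrite -scaleN1r starZ rmorphN rmorph1 scaleN1r. Qed.

Lemma starB a b : star (a - b) = star a - star b.
Proof. by rewrite starD starN. Qed.

Lemma star_real (t : R) : star (t%:C *: (1 : A)) = t%:C *: (1 : A).
Proof. by rewrite starZ star1 conj_Creal // complex_real. Qed.

Lemma rnorm_star_mul a : rnorm (star a * a) = rnorm a ^+ 2.
Proof. by apply: complexI; rewrite rmorphXn /= -!rnormE; exact: cstar_norm. Qed.

(** From |a| ^ 2 = |a^* a| <= |a^*| |a|. *)
Lemma rnorm_le_star a : rnorm a <= rnorm (star a).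
Proof.
have [->|/eqP a0] := eqVneq a 0; first by rewrite rnorm0 rnorm_ge0.
have := crnormM (star a) a; rewrite rnorm_star_mul expr2.
by rewrite ler_pM2r // rnorm_gt0.
Qed.

Lemma rnorm_star a : rnorm (star a) = rnorm a.
Proof. by apply/le_anti; rewrite rnorm_le_star -{2}(starK a) rnorm_le_star. Qed.

Lemma rnorm1_le : rnorm (1 : A) <= 1.
Proof.
have := rnorm_star_mul 1; rewrite star1 mulr1 => n1.
have := rnorm_ge0 (1 : A); nra.
Qed.

Lemma rnorm_scalar_le (t : R) : 0 <= t -> rnorm (t%:C *: (1 : A)) <= t.
Proof. by move=> t0; rewrite crnormZ rnorm_real // ler_piMr // rnorm1_le. Qed.

Lemma rnormX_le a n : rnorm (a ^+ n) <= rnorm a ^+ n.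
Proof.
elim: n => [|n IH]; first by rewrite !expr0 rnorm1_le.
by rewrite !exprS (le_trans (crnormM _ _)) // ler_wpM2l ?rnorm_ge0.
Qed.

Lemma cstar_complete : complete_space (T := A).
Proof. by move=> F FF cF; exact: cauchy_cvg. Qed.

Lemma inverse_ofZ k x u : k != 0 -> inverse_of x u ->
  inverse_of (k *: x) (k^-1 *: u).
Proof.
move=> k0 [xu ux]; split; rewrite cscaleAl cscaleAr scalerA ?mulfV ?mulVf //.
  by rewrite xu scale1r.
by rewrite ux scale1r.
Qed.

Lemma neumann x : rnorm x < 1 -> exists v, inverse_of (1 - x) v.
Proof.
move=> x1; have x0 := rnorm_ge0 x.
pose u n : A := \sum_(i < n) x ^+ i.
have [|l lu] := geometric_limit (u := u) (K := 1) cstar_complete x0 x1.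
  by move=> k; rewrite /u big_ord_recr /= addrAC subrr add0r mul1r rnormX_le.
have xu n : (1 - x) * u n = 1 - x ^+ n.
  by rewrite -opprB mulNr -subrX1 opprB.
have ux n : u n * (1 - x) = 1 - x ^+ n.
  rewrite -xu /u mulr_suml mulr_sumr; apply: eq_bigr => i _.
  by rewrite mulrBr mulrBl mulr1 mul1r -exprS -exprSr.
pose C := (1 + rnorm x) / (1 - rnorm x) + 1.
have n1x : rnorm (1 - x) <= 1 + rnorm x.
  by rewrite (le_trans (rnormB _ _)) // lerD2r rnorm1_le.
(* C is chosen to absorb both the tail of the series and the power x ^+ n. *)
have lun n : rnorm (1 - x) * rnorm (l - u n) + rnorm (x ^+ n) <= C * rnorm x ^+ n.
  rewrite /C mulrDl mul1r lerD ?rnormX_le //.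
  rewrite (le_trans (ler_pM (rnorm_ge0 _) (rnorm_ge0 _) n1x (lu n))) //.
  by rewrite mul1r mulrCA mulrC -!mulrA [(1 - _)^-1 * _]mulrC.
exists l; split; apply/eqP; rewrite -subr_eq0; apply/eqP;
  apply: (geometric_rnorm_eq0 x0 x1 (C := C)) => n.
  have -> : (1 - x) * l - 1 = (1 - x) * (l - u n) - x ^+ n.
    by rewrite [in RHS]mulrBr xu opprB addrA addrAC addrK.
  by rewrite (le_trans (rnormB _ _)) // (le_trans _ (lun n)) // lerD2r crnormM.
have -> : l * (1 - x) - 1 = (l - u n) * (1 - x) - x ^+ n.
  by rewrite [in RHS]mulrBl ux opprB addrA addrAC addrK.
rewrite (le_trans (rnormB _ _)) // (le_trans _ (lun n)) // lerD2r.
by rewrite mulrC crnormM.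
Qed.

Lemma neumann_half x : rnorm x <= 2^-1 ->
  exists2 v, inverse_of (1 - x) v & rnorm v <= 2.
Proof.
move=> x2; have [|v iv] := @neumann x; first by lra.
exists v => //; case: iv => + _; rewrite mulrBl mul1r => /eqP.
rewrite subr_eq => /eqP v1.
have := rnormD (1 : A) (x * v : A); have := crnormM x v; rewrite -v1.
have := rnorm1_le; have := rnorm_ge0 v; have := rnorm_ge0 x; nra.
Qed.

Lemma resolvent_neumann k a : rnorm a < rnorm k ->
  invertible (k *: (1 : A) - a).
Proof.
move=> ak; have k0 : k != 0.
  by apply: contraTneq ak => ->; rewrite rnorm0 -leNgt rnorm_ge0.
have [|v iv] := @neumann (k^-1 *: a).
  rewrite crnormZ; have := rnormM k^-1 k; rewrite mulVf //.
  have -> : rnorm (1 : R[i]) = 1 by rewrite (@rnorm_real _ 1).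
  have := rnorm_ge0 a; have := rnorm_ge0 k^-1; nra.
exists (k^-1 *: v); have := inverse_ofZ k0 iv.
by rewrite scalerBr scalerA mulfV // scale1r.
Qed.

(** Invertibility is an open condition: y = x (1 - u (x - y)), and the second
    factor is inverted by a Neumann series of ratio at most 1/2. *)
Lemma inverse_of_near x u y : inverse_of x u ->
  rnorm u * rnorm (x - y) <= 2^-1 ->
  exists2 v, inverse_of y v & rnorm v <= 2 * rnorm u.
Proof.
move=> [xu ux] small; have [|w [yw wy] w2] := @neumann_half (u * (x - y)).
  by rewrite (le_trans (crnormM _ _)).
have Ey : y = x * (1 - u * (x - y)).
  by rewrite mulrBr mulr1 mulrA xu mul1r subKr.
exists (w * u).
  split; first by rewrite {1}Ey mulrA -(mulrA x) yw mulr1.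
  by rewrite {1}Ey mulrA -(mulrA w) ux mulr1.
by rewrite (le_trans (crnormM _ _)) // ler_wpM2r // rnorm_ge0.
Qed.

Lemma inverse_of_diff x y u v : inverse_of x u -> inverse_of y v ->
  u - v = u * (y - x) * v.
Proof.
move=> [_ ux] [yv _].
by rewrite mulrBr mulrBl ux mul1r -mulrA yv mulr1.
Qed.

End Invertibility.
(** * Resolvents along the unit circle *)

Section SpectralRadius.
Context {R : realType} {A : cstarAlgType R}.
Implicit Types (a b c h u v x y : A) (k l z : R[i]).

(** Partial fractions: 2 / (1 - a ^ 2) = 1 / (1 - a) + 1 / (1 + a). *)
Lemma inverse_of_sqr a u v : inverse_of (1 - a) u -> inverse_of (1 + a) v ->
  inverse_of (1 - a * a) (2^-1 *: (u + v)).
Proof.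
have two : 2^-1 *: (2 : A) = 1.
  have -> : (2 : A) = (2 : R[i]) *: (1 : A) by rewrite scaler_nat.
  by rewrite scalerA mulVf ?scale1r // pnatr_eq0.
have E : (1 - a) * (1 + a) = 1 - a * a.
  by rewrite mulrDr mulr1 mulrBl mul1r addrA subrK.
have E' : (1 + a) * (1 - a) = 1 - a * a.
  by rewrite mulrBr mulr1 mulrDl mul1r opprD addrA addrK.
move=> [au ua] [av va]; split.
  rewrite cscaleAr mulrDr -{1}E' -E -!mulrA au av !mulr1 addrACA subrr addr0.
  exact: two.
rewrite cscaleAl mulrDl -{1}E -E' !mulrA ua va !mul1r addrACA subrr addr0.
exact: two.
Qed.

(** The resolvents of h at a point of the unit circle and at its dilation by r
    are close, uniformly on the circle.  The property passes from (h, r) to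
    (h * h, r * r), so that h can be replaced by its powers of exponent 2 ^ n
    while the dilation factor tends to 0. *)
Definition resolvent_close h (r : R) := forall z, rnorm z = 1 ->
  exists u v, [/\ inverse_of (1 - z *: h) u,
    inverse_of (1 - (r%:C * z) *: h) v & rnorm (u - v) <= 4^-1].

(** The resolvent of h * h at w ^+ 2 is the mean of those of h at w and - w,
    so that the bound on the difference is inherited without loss. *)
Lemma resolvent_close_sqr h r :
  resolvent_close h r -> resolvent_close (h * h) (r * r).
Proof.
move=> hr z z1; pose w := sqrtc z.
have ww : w * w = z by rewrite -expr2 sqr_sqrtc.
have w1 : rnorm w = 1.
  have := rnormM w w; rewrite ww z1; have := rnorm_ge0 w; nra.
have [u [v [iu iv uv]]] := hr w w1.
have [|u' [v' [iu' iv' uv']]] := hr (- w); first by rewrite rnormN.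
have hh k : (k *: h) * (k *: h) = (k * k) *: (h * h).
  by rewrite cscaleAl cscaleAr scalerA.
exists (2^-1 *: (u + u')), (2^-1 *: (v + v')); split.
- rewrite -ww -hh; apply: inverse_of_sqr => //.
  by move: iu'; rewrite scaleNr opprK.
- rewrite rmorphM -ww mulrACA -hh; apply: inverse_of_sqr => //.
  by move: iv'; rewrite mulrN scaleNr opprK.
- rewrite -scalerBr opprD addrACA crnormZ.
  have -> : rnorm (2^-1 : R[i]) = 2^-1.
    by rewrite -[2^-1]/((2 : R[i])^-1) -(rmorph_nat (real_complex R)) -fmorphV rnorm_real.
  by have := rnormD (u - v) (u' - v'); lra.
Qed.

Lemma resolvent_close_exp2 h r n : resolvent_close h r ->
  resolvent_close (h ^+ (2 ^ n)) (r ^+ (2 ^ n)).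
Proof.
move=> hr; elim: n => [|n IH]; first by rewrite expn0 !expr1.
by rewrite expnS mulnC !exprM !expr2; exact: resolvent_close_sqr.
Qed.

(** Iterating |h ^ 2| = |h^* h| = |h| ^ 2. *)
Lemma rnorm_selfadj_exp2 h n : star h = h ->
  rnorm (h ^+ (2 ^ n)) = rnorm h ^+ (2 ^ n).
Proof.
move=> sh; have shn m : star (h ^+ m) = h ^+ m.
  elim: m => [|m IH]; first by rewrite expr0 star1.
  by rewrite exprS cstarM IH sh -exprSr exprS.
elim: n => [|n IH]; first by rewrite expn0 !expr1.
rewrite expnS mulnC !exprM -IH -rnorm_star_mul shn expr2 //.
Qed.

(** A locally bounded function is bounded on the compact unit circle.  The circle
    is the union of two graphs over the segment [-1, 1], that of the square root
    of 1 - x ^ 2 and its opposite, so that compactness of the segment suffices. *)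
Lemma resolvent_bounded h :
  (forall z, rnorm z = 1 -> invertible (1 - z *: h)) ->
  exists C : R, forall z, rnorm z = 1 ->
    exists2 u, inverse_of (1 - z *: h) u & rnorm u <= C.
Proof.
move=> inv.
have circle z : rnorm z = 1 -> complex.Re z ^+ 2 + complex.Im z ^+ 2 = 1.
  by move=> z1; apply: complexI; rewrite add_Re2_Im2 rnormE z1 expr1n.
have coord z : rnorm z <= `|complex.Re z| + `|complex.Im z|.
  rewrite {1}(complexE z) (le_trans (rnormD _ _)) // rnormM.
  have rr (t : R) : rnorm (t%:C) = `|t|.
    by apply: complexI; rewrite -rnormE normc_def /= expr0n addr0 sqrtr_sqr.
  rewrite !rr lerD2l ler_piMl // /rnorm normc_def /= expr0n expr1n add0r.
  by rewrite sqrtr1.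
have local z : rnorm z = 1 -> exists2 d : R, 0 < d & exists C, forall z',
    rnorm (z - z') < d ->
    exists2 u, inverse_of (1 - z' *: h) u & rnorm u <= C.
  move=> /inv[u iu]; pose D := 2 * (rnorm u * rnorm h + 1).
  have D0 : 0 < D by rewrite mulr_gt0 // ltr_wpDl // mulr_ge0 // rnorm_ge0.
  exists D^-1; first by rewrite invr_gt0.
  exists (2 * rnorm u) => z' zz'; apply: inverse_of_near iu _.
  rewrite opprD opprK addrACA subrr add0r addrC -scalerBl crnormZ rnormBC.
  move: zz'; rewrite -[D^-1]div1r ltr_pdivlMr // /D.
  have := rnorm_ge0 u; have := rnorm_ge0 h; have := rnorm_ge0 (z - z').
  set X := rnorm (z - z'); set Y := rnorm u; set Z := rnorm h => X0 Z0 Y0.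
  nra.
pose P (n : nat) (x : R) := forall z, rnorm z = 1 -> complex.Re z = x ->
  exists2 u, inverse_of (1 - z *: h) u & rnorm u <= n%:R.
have /compact_near_coveringP K := @segment_compact R (-1) 1.
have [|n _ nP] := K nat \oo P _.
  move=> x; rewrite /= in_itv /= => /andP[x1 x2].
  pose s (t : R) := Num.sqrt (1 - t ^+ 2).
  have s2 : s x ^+ 2 = 1 - x ^+ 2 by rewrite sqr_sqrtr //; nra.
  have n1 (e : R) : e ^+ 2 = 1 -> rnorm (x +i* (e * s x)) = 1.
    move=> e1; apply: complexI; rewrite -rnormE normc_def /= exprMn e1 mul1r.
    by rewrite s2 addrCA subrr addr0 sqrtr1.
  have [d d0 [C HC]] := local _ (n1 1 (expr1n _ _)).
  have [d' d'0 [C' HC']] := local _ (n1 (-1) (etrans (sqrrN _) (expr1n _ _))).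
  pose e := Num.min d d' / 2.
  have e0 : 0 < e by rewrite divr_gt0 // lt_min d0.
  have [m mC] : exists m : nat, Num.max C C' <= m%:R.
    by exists (Num.truncn (Num.max C C')).+1; rewrite ltW // truncnS_gt.
  have cs : s @ x --> s x.
    apply: (@cvg_comp _ _ _ (fun t => 1 - t ^+ 2) Num.sqrt _ (nbhs (1 - x ^+ 2)));
      last exact: sqrt_continuous.
    by apply: cvgB; [exact: cvg_cst|exact: exprn_continuous].
  near=> x' n => z z1 /= zx'.
  have x'e : `|x - x'| < e by near: x'; exact: cvgr_dist_lt.
  have sx'e : `|s x - s x'| < e by near: x'; move/cvgrPdist_lt : cs; apply.
  have mn : m%:R <= n%:R :> R by rewrite ler_nat; near: n; exact: nbhs_infty_ge.
  have Imz : `|complex.Im z| = s x'.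
    by rewrite /s -zx' -(circle _ z1) addrAC subrr add0r sqrtr_sqr.
  have near_z (t : R) : `|t - complex.Im z| = `|s x - s x'| ->
      rnorm ((x +i* t) - z) < Num.min d d'.
    move=> tz; rewrite (le_lt_trans (coord _)) //.
    case: (z) zx' tz => z1' z2' /= -> ->.
    by rewrite [ltRHS]splitr ltrD.
  have [Im0|Im0] := leP 0 (complex.Im z).
    have [|u iu uC] := HC z; last exists u => //.
      rewrite (lt_le_trans (near_z _ _)) ?ge_min ?lexx // mul1r.
      by rewrite -Imz (ger0_norm Im0).
    by rewrite (le_trans uC) // (le_trans _ mn) // (le_trans _ mC) // le_max lexx.
  have [|u iu uC] := HC' z; last exists u => //.
    rewrite (lt_le_trans (near_z _ _)) ?ge_min ?lexx ?orbT // mulN1r.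
    by rewrite -Imz (ltr0_norm Im0) -normrN opprD !opprK.
  by rewrite (le_trans uC) // (le_trans _ mn) // (le_trans _ mC) // le_max lexx orbT.
exists n%:R => z z1; apply: (nP n (leqnn n) (complex.Re z)) => //=.
rewrite in_itv /=; have := circle z z1; nra.
Unshelve. all: by end_near. Qed.

End SpectralRadius.
(** * Positive elements *)

Section Positivity.
Context {R : realType} {A : cstarAlgType R}.
Implicit Types (a b c h u v x y : A) (k l z : R[i]).

(** Rickart's argument.  If the resolvent existed on the whole circle it would be
    bounded there, hence close to its values on a slightly smaller circle of
    radius r.  Passing to g = h ^ (2 ^ n) keeps the difference small, while
    1 / (1 - r ^ (2 ^ n) g) tends to 1; so 1 / (1 - g) is within 3/8 of 1, which
    is incompatible with |g| = 1. *)
Lemma resolvent_singular h : star h = h -> rnorm h = 1 ->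
  exists2 z, rnorm z = 1 & ~ invertible (1 - z *: h).
Proof.
move=> sh h1; apply: contrapT => noz.
have [z z1|C HC] := @resolvent_bounded _ _ h.
  by apply: contrapT => zh; apply: noz; exists z.
(* d makes both D d <= 1/2 and 2 D ^ 2 d <= 1/4 true. *)
pose D := Num.max C 1; pose d := (8 * D ^+ 2)^-1; pose r := 1 - d.
have D1 : 1 <= D by rewrite le_max lexx orbT.
have dD : d * (8 * D ^+ 2) = 1 by rewrite /d mulVf // gt_eqF //; nra.
have d0 : 0 < d by rewrite /d invr_gt0; nra.
have r0 : 0 <= r by rewrite /r; nra.
have r1 : r < 1 by rewrite /r; lra.
have hr : resolvent_close h r.
  move=> z z1; have [u iu uC] := HC z z1.
  have uD : rnorm u <= D by rewrite (le_trans uC) // le_max lexx.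
  have E : rnorm (1 - z *: h - (1 - (r%:C * z) *: h)) = d.
    rewrite opprB addrC addrA subrK -scalerBl -{2}[z]mul1r -mulrBl.
    rewrite crnormZ rnormM z1 h1 !mulr1 /r rmorphB rmorph1 rnormBC opprB addrC subrK.
    by rewrite rnorm_real // ltW.
  have [|v iv vu] := @inverse_of_near _ _ _ _ (1 - (r%:C * z) *: h) iu.
    by rewrite E; have := rnorm_ge0 u; nra.
  exists u, v; split => //; rewrite (inverse_of_diff iu iv).
  rewrite (le_trans (crnormM _ _)) // (@le_trans _ _ (rnorm u * d * rnorm v)) //.
    by rewrite ler_wpM2r ?rnorm_ge0 // (le_trans (crnormM _ _)) // rnormBC E.
  have u0 := rnorm_ge0 u; have v0 := rnorm_ge0 v.
  have : rnorm u * rnorm v <= 2 * D ^+ 2 by nra.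
  nra.
have [n rn] : exists n, r ^+ n < 16^-1 by apply: exprn_small.
have {}rn : r ^+ (2 ^ n) <= 16^-1.
  by rewrite (le_trans _ (ltW rn)) // ler_wiXn2l ?(ltW r1) // ltnW // ltn_expl.
have := resolvent_close_exp2 n hr; have := rnorm_selfadj_exp2 n sh.
rewrite h1 expr1n; set g := h ^+ _ => g1 /(_ 1).
rewrite (@rnorm_real _ 1) // => /(_ erefl)[u [v [[_ ug] [_ vg] uv]]].
have r'0 : 0 <= r ^+ (2 ^ n) by rewrite exprn_ge0.
set r' := r ^+ _ in rn vg r'0.
have vE : v - 1 = r'%:C *: (v * g).
  by rewrite -vg mulrBr mulr1 mulr1 subKr -cscaleAr.
have v1 : rnorm (v - 1) <= 16^-1 * rnorm v.
  rewrite vE crnormZ rnorm_real // ler_pM ?rnorm_ge0 //.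
  by rewrite (le_trans (crnormM _ _)) // g1 mulr1.
have v2 : rnorm v <= rnorm (v - 1) + 1.
  by rewrite -{1}(subrK 1 v) (le_trans (rnormD _ _)) // lerD2l rnorm1_le.
have u1 : rnorm (u - 1) <= 3 / 8.
  rewrite (le_trans (rnorm_triangle v _ _)) //; lra.
have gE : g = (u - 1) * (1 - g) .
  by rewrite mulrBl mul1r -{2}[g]scale1r ug opprB addrC subrK.
have : rnorm (1 - g) <= 2 by rewrite (le_trans (rnormB _ _)) // g1 lerD2r rnorm1_le.
have := crnormM (u - 1) (1 - g); rewrite -gE g1.
by have := rnorm_ge0 (u - 1); have := rnorm_ge0 (1 - g); nra.
Qed.

Lemma selfadj_spectrum_norm c : star c = c -> 0 < rnorm c ->
  exists2 l, spectrum c l & rnorm l = rnorm c.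
Proof.
move=> sc c0; pose h := (rnorm c)^-1%:C *: c.
have c0' : (rnorm c)%:C != 0 by rewrite fmorph_eq0 gt_eqF.
have [||z z1 zh] := @resolvent_singular h.
- by rewrite /h starZ sc conj_Creal // complex_real.
- by rewrite /h crnormZ rnorm_real ?mulVf ?gt_eqF // invr_ge0 ltW.
have z0 : z != 0.
  by apply/eqP => z0; move: z1 => /eqP; rewrite z0 rnorm0 eq_sym oner_eq0.
have zV : rnorm z^-1 = 1.
  by have := rnormM z^-1 z; rewrite mulVf // z1 mulr1 (@rnorm_real _ 1).
exists ((rnorm c)%:C * z^-1); last first.
  by rewrite rnormM zV mulr1 rnorm_real // ltW.
rewrite /spectrum /= => -[u iu]; apply: zh.
have l0 : ((rnorm c)%:C * z^-1)^-1 != 0.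
  by rewrite invr_eq0 mulf_neq0 // invr_eq0.
exists (((rnorm c)%:C * z^-1)^-1^-1 *: u); have := inverse_ofZ l0 iu.
rewrite scalerBr scalerA mulVf ?scale1r; last by rewrite -invr_eq0.
by rewrite /h scalerA fmorphV invfM invrK mulrC.
Qed.

(** For self-adjoint b this says that the spectrum lies in the half-line of
    nonnegative reals; unlike the spectral form, it is additive by the triangle
    inequality. *)
Definition norm_pos b := exists s0 : R, forall s : R, s0 <= s ->
  rnorm (s%:C *: (1 : A) - b) <= s.

Lemma norm_posD b c : norm_pos b -> norm_pos c -> norm_pos (b + c).
Proof.
move=> [s0 Hb] [s1 Hc]; exists (s0 + s1) => s ss.
have -> : s%:C *: (1 : A) - (b + c) =
    (s0%:C *: (1 : A) - b) + ((s - s0)%:C *: (1 : A) - c).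
  by rewrite addrACA -scalerDl -rmorphD /= [s0 + _]addrC subrK -opprD.
rewrite (le_trans (rnormD _ _)) // -[leRHS](subrK s0) addrC lerD //.
  by apply: Hc; lra.
by apply: Hb.
Qed.

(** If |t - a| > t >= |a|, then t - a has a spectral value of modulus |t - a|; it is
    at most t since a is positive, so it is - |t - a|.  Then t + |t - a| > |a| is a
    spectral value of a, against the Neumann series. *)
Lemma cstar_pos_norm_pos a : cstar_pos a -> norm_pos a.
Proof.
move=> [sa pa]; exists (rnorm a) => t at_.
have t0 : 0 <= t := le_trans (rnorm_ge0 _) at_.
rewrite leNgt; apply/negP => tc; set c := _ - a in tc.
have sc : star c = c by rewrite starB sa star_real.
have [l lc ln] := selfadj_spectrum_norm sc (le_lt_trans t0 tc).
have : spectrum a (t%:C - l).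
  have E : (t%:C - l) *: (1 : A) - a = - (l *: (1 : A) - c).
    by rewrite scalerBl addrAC opprB.
  rewrite /spectrum /= E => -[u [iu ui]]; apply: lc; exists (- u).
  by split; [rewrite mulrN -mulNr iu|rewrite mulNr -mulrN ui].
move=> la; have := pa _ la.
rewrite lecE => /andP[/eqP]; rewrite /= => imtl retl.
have lE : l = - (rnorm c)%:C.
  have lR : l = (complex.Re l)%:C.
    move: imtl retl ln; case: (l) => x y /=.
    by rewrite sub0r => /eqP; rewrite oppr_eq0 => /eqP ->.
  move: retl ln; rewrite lR /= => retl ln.
  have [x0|x0] := leP 0 (complex.Re l).
    by move: tc; rewrite -ln rnorm_real // ltNge -subr_ge0 retl.
  move: ln; rewrite -rnormN -rmorphN rnorm_real ?oppr_ge0 ?ltW // => <-.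
  by rewrite rmorphN /= opprK.
apply: la; apply: resolvent_neumann.
rewrite lE opprK -rmorphD rnorm_real;
  first by rewrite (le_lt_trans at_) // ltrDl (le_lt_trans t0 tc).
by rewrite addr_ge0 // rnorm_ge0.
Qed.

(** The norm |a| of the positive element a is itself a spectral value, hence
    s + |a| is one of s + a.  But s + a = (s - b) + (a + b) has norm at most
    s + |a + b| when s is large. *)
Lemma rnorm_le_add a b : cstar_pos a -> norm_pos b -> rnorm a <= rnorm (a + b).
Proof.
move=> [sa pa] [s0 Hb]; rewrite leNgt; apply/negP => ab.
have a0 : 0 < rnorm a := le_lt_trans (rnorm_ge0 _) ab.
have [l la ln] := selfadj_spectrum_norm sa a0.
pose s := Num.max s0 0; have s00 : 0 <= s by rewrite le_max lexx orbT.
have sb : rnorm (s%:C *: (1 : A) - b) <= s by apply: Hb; rewrite le_max lexx.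
apply: (la).
have -> : l *: (1 : A) - a = (l + s%:C) *: (1 : A) - (s%:C *: (1 : A) + a).
  by rewrite scalerDl opprD addrA addrK.
apply: resolvent_neumann.
have l0 := pa _ la; have lE : l = (rnorm l)%:C by rewrite -rnormE ger0_norm.
rewrite lE -rmorphD rnorm_real ?addr_ge0 ?rnorm_ge0 // ln.
have -> : s%:C *: (1 : A) + a = (s%:C *: (1 : A) - b) + (a + b).
  by rewrite addrA addrAC subrK.
by rewrite (le_lt_trans (rnormD _ _)) // addrC ltr_leD.
Qed.

End Positivity.
(** * Hilbert modules and orthogonal complements *)

Section HilbertModules.
Context {R : realType} {A : cstarAlgType R}.
Implicit Types (M N : hilbertModType A) (a b : A).

Section Inner.
Context {M : hilbertModType A}.
Implicit Types x y z : M.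

Lemma innerDl x y z : inner (x + y) z = inner x z + inner y z.
Proof. by rewrite innerC innerDr starD -!innerC. Qed.

Lemma innerMl x y a : inner (ract x a) y = star a * inner x y.
Proof. by rewrite innerC innerMr cstarM -innerC. Qed.

Lemma inner0r x : inner x 0 = 0.
Proof. by apply: (addrI (inner x 0)); rewrite -innerDr !addr0. Qed.

Lemma innerNr x y : inner x (- y) = - inner x y.
Proof. by apply: (addrI (inner x y)); rewrite -innerDr !subrr inner0r. Qed.

Lemma innerBr x y z : inner x (y - z) = inner x y - inner x z.
Proof. by rewrite innerDr innerNr. Qed.

Lemma inner0l x : inner 0 x = 0.
Proof. by apply: (addrI (inner 0 x)); rewrite -innerDl !addr0. Qed.

Lemma innerNl x y : inner (- x) y = - inner x y.
Proof. by apply: (addrI (inner x y)); rewrite -innerDl !subrr inner0l. Qed.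

Lemma inner_sumr (I : Type) (r : seq I) (f : I -> M) x :
  inner x (\sum_(i <- r) f i) = \sum_(i <- r) inner x (f i).
Proof. by apply: (big_morph _ (innerDr x) (inner0r x)). Qed.

Lemma inner_eq0C x y : inner x y = 0 -> inner y x = 0.
Proof.
move=> xy0; rewrite innerC xy0; apply: (addrI (star 0)).
by rewrite -starD !addr0.
Qed.

Lemma ract0 x : ract x 0 = 0.
Proof. exact: (@scale0r A^c M x). Qed.

Lemma ractNl x a : ract (- x) a = - ract x a.
Proof. exact: (@scalerN A^c M a x). Qed.

Lemma ract0l a : ract (0 : M) a = 0.
Proof. exact: (@scaler0 A^c M a). Qed.

Lemma ractNr x a : ract x (- a) = - ract x a.
Proof. exact: (@scaleNr A^c M a x). Qed.

Lemma rnorm_inner x : rnorm (inner x x) = rnorm x ^+ 2.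
Proof. by apply: complexI; rewrite rmorphXn /= -!rnormE; rewrite hilbert_norm. Qed.

Lemma rnorm_ract x a : rnorm (ract x a) <= rnorm x * rnorm a.
Proof.
have : rnorm (ract x a) ^+ 2 <= (rnorm x * rnorm a) ^+ 2.
  rewrite -rnorm_inner innerMr innerMl.
  have -> : (rnorm x * rnorm a) ^+ 2 = rnorm a * rnorm x ^+ 2 * rnorm a by ring.
  rewrite (le_trans (crnormM _ _)) // ler_wpM2r ?rnorm_ge0 //.
  by rewrite (le_trans (crnormM _ _)) // rnorm_star rnorm_inner.
by rewrite ler_pXn2r // ?nnegrE ?mulr_ge0 ?rnorm_ge0.
Qed.

(** Polarization of x against w = y b^*, where b = <x, y>: as <x, w> = b b^* is
    self-adjoint, 4 b b^* = <x + w, x + w> - <x - w, x - w>, whence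
    |b| ^ 2 <= (1 + |b|) ^ 2 / 2 and |b| <= 1 + sqrt 2 < 3. *)
Let inner_small x y : rnorm x <= 1 -> rnorm y <= 1 -> rnorm (inner x y) <= 3.
Proof.
move=> x1 y1; set b := inner x y; pose w := ract y (star b).
have xw : inner x w = b * star b by rewrite innerMr.
have wx : inner w x = b * star b by rewrite innerMl starK (innerC x y).
have E : inner (x + w) (x + w) - inner (x - w) (x - w) = (4 : R[i]) *: (b * star b).
  rewrite !innerDl !innerDr !innerNl !innerNr xw wx opprK.
  set p := inner x x; set q := inner w w; set c := b * star b.
  rewrite !opprD !opprK addrACA [p + c + _]addrACA [c + q + _]addrACA !subrr.
  by rewrite add0r addr0 -!mulr2n -mulrnA scaler_nat.
have nw : rnorm w <= rnorm b.
  have := rnorm_ract y (star b); rewrite rnorm_star => /le_trans; apply.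
  by rewrite ler_piMl // rnorm_ge0.
have bb : rnorm (b * star b) = rnorm b ^+ 2.
  by rewrite -{1}(starK b) rnorm_star_mul rnorm_star.
have := rnormB (inner (x + w) (x + w)) (inner (x - w) (x - w)).
rewrite E !rnorm_inner crnormZ bb.
have -> : rnorm (4 : R[i]) = 4 by rewrite -(rmorph_nat (real_complex R)) rnorm_real.
have := rnormD x w; have := rnormB x w.
have := rnorm_ge0 (x + w); have := rnorm_ge0 (x - w); have := rnorm_ge0 b.
have := rnorm_ge0 x; have := rnorm_ge0 w.
set X := rnorm (x + w); set Y := rnorm (x - w); set B := rnorm b => w0 x0 B0 Y0 X0 HX HY H.
have HX' : X ^+ 2 <= (1 + B) ^+ 2 by rewrite ler_pXn2r // ?nnegrE; lra.
have HY' : Y ^+ 2 <= (1 + B) ^+ 2 by rewrite ler_pXn2r // ?nnegrE; lra.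
by nra.
Qed.

Definition rscal (t : R) x := ract x (t%:C *: (1 : A)).

Lemma rscalD t x y : rscal t (x + y) = rscal t x + rscal t y.
Proof. exact: ractDl. Qed.

Lemma rscalA s t x : rscal s (rscal t x) = rscal (s * t) x.
Proof. by rewrite /rscal -ractM cscaleAl mul1r scalerA rmorphM mulrC. Qed.

Lemma rscalN t x : rscal t (- x) = - rscal t x.
Proof. exact: ractNl. Qed.

Lemma rscalDt s t x : rscal (s + t) x = rscal s x + rscal t x.
Proof. by rewrite /rscal rmorphD scalerDl ractDr. Qed.

Lemma rscal0t x : rscal 0 x = 0.
Proof. by rewrite /rscal scale0r ract0. Qed.

Lemma rscal1 x : rscal 1 x = x.
Proof. by rewrite /rscal scale1r ract1. Qed.

Lemma inner_rscalr t x y : inner x (rscal t y) = t%:C *: inner x y.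
Proof. by rewrite innerMr cscaleAr mulr1. Qed.

Lemma inner_rscall t x y : inner (rscal t x) y = t%:C *: inner x y.
Proof. by rewrite innerMl star_real cscaleAl mul1r. Qed.

Lemma rnorm_rscal t x : 0 <= t -> rnorm (rscal t x) = t * rnorm x.
Proof.
move=> t0; apply/eqP; rewrite -(@eqrXn2 _ 2) ?mulr_ge0 ?rnorm_ge0 //.
rewrite -rnorm_inner inner_rscalr inner_rscall !crnormZ rnorm_real //.
by rewrite rnorm_inner exprMn mulrA -expr2.
Qed.

Lemma rnorm_inner_le x y : rnorm (inner x y) <= 3 * rnorm x * rnorm y.
Proof.
have [->|/eqP/rnorm_gt0 x0] := eqVneq x 0.
  by rewrite inner0l !rnorm0 mulr0 mul0r.
have [->|/eqP/rnorm_gt0 y0] := eqVneq y 0.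
  by rewrite inner0r !rnorm0 mulr0.
have unit z : 0 < rnorm z -> rnorm (rscal (rnorm z)^-1 z) <= 1.
  by move=> z0; rewrite rnorm_rscal ?mulVf ?gt_eqF // invr_ge0 ltW.
have := inner_small (unit _ x0) (unit _ y0).
rewrite inner_rscall inner_rscalr !crnormZ !rnorm_real ?invr_ge0 ?rnorm_ge0 //.
by rewrite mulrA -invfM mulrC ler_pdivrMr ?mulr_gt0 // mulrA.
Qed.

Lemma rnorm_orthoD x y : inner x y = 0 -> rnorm x <= rnorm (x + y).
Proof.
move=> xy; have yx := inner_eq0C xy.
have := @rnorm_le_add _ _ _ _ (inner_pos x) (cstar_pos_norm_pos (inner_pos y)).
have -> : inner x x + inner y y = inner (x + y) (x + y).
  by rewrite innerDl !innerDr xy yx addr0 add0r.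
by rewrite !rnorm_inner ler_pXn2r // ?nnegrE rnorm_ge0.
Qed.

End Inner.

Section Submodules.
Context {M : hilbertModType A}.
Implicit Types (x y z : M) (S T : set M).

(** Closure properties of a submodule over the algebra, stated on sets rather than
    on boolean predicates. *)
Definition submodule S :=
  [/\ S 0, forall x y, S x -> S y -> S (x + y) & forall x a, S x -> S (ract x a)].

Lemma submoduleP S : submod_closed [in S] <-> submodule S.
Proof.
split=> [[S0 SZ]|[S0 SD SM]].
  have S0' : S 0 by move: S0; rewrite inE.
  have SZ' x y a : S x -> S y -> S (ract x a + y).
    by move=> Sx Sy; have := SZ a x y; rewrite !inE; apply.
  split=> // [x y Sx Sy|x a Sx].
    by rewrite -[x]ract1; exact: SZ'.
  by rewrite -[ract x a]addr0; exact: SZ'.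
split=> [|a x y]; rewrite !inE // => Sx Sy.
by apply: SD => //; exact: SM.
Qed.

Lemma submoduleN S x : submodule S -> S x -> S (- x).
Proof. by move=> [_ _ SM] Sx; rewrite -[x]ract1 -ractNr; exact: SM. Qed.

Lemma submoduleB S x y : submodule S -> S x -> S y -> S (x - y).
Proof. by move=> mS Sx Sy; case: (mS) => _ SD _; apply: SD => //; exact: submoduleN. Qed.

Lemma submodule_sum S (I : Type) (r : seq I) (f : I -> M) :
  submodule S -> (forall i, S (f i)) -> S (\sum_(i <- r) f i).
Proof. by move=> [S0 SD _] Sf; elim/big_ind : _. Qed.

Lemma orthocomp_submodule S : submodule (orthocomp S).
Proof.
split=> [y Sy|x z Sx Sz y Sy|x a Sx y Sy]; first exact: inner0r.
  by rewrite innerDr Sx // Sz // addr0.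
by rewrite innerMr Sx // mul0r.
Qed.

Lemma orthocomp_closed S : closed (orthocomp S).
Proof.
apply/closed_rnormP => x xS y Sy; apply: contrapT => /rnorm_gt0 xy.
have y0 : 0 < 3 * rnorm y + 1.
  by rewrite ltr_wpDl // mulr_ge0 // rnorm_ge0.
have [z Sz] := xS _ (divr_gt0 xy y0).
rewrite ltr_pdivlMr //.
have := rnorm_inner_le y (x - z); rewrite innerBr (Sz y) // subr0.
by have := rnorm_ge0 (x - z); nra.
Qed.

Lemma orthocomp_closed_submodule S : closed_submodule (orthocomp S).
Proof. by split; [exact/submoduleP/orthocomp_submodule|exact: orthocomp_closed]. Qed.

Lemma orthocomp_meet S x : S x -> orthocomp S x -> x = 0.
Proof. by move=> Sx Ox; apply: inner_def; exact: Ox. Qed.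

Lemma orthogonally_complementable_exists S : submodule S ->
  (forall x, exists2 y, S y & orthocomp S (x - y)) ->
  orthogonally_complementable S.
Proof.
move=> [S0 _ _] dec; split=> [x|].
  by have [y Sy Oy] := dec x; exists y, (x - y); split=> //; rewrite addrC subrK.
apply/seteqP; split=> [x [Sx Ox]|x ->]; first exact: orthocomp_meet Ox.
by split=> //; case: (orthocomp_submodule S).
Qed.

Lemma orthocompK S : orthogonally_complementable S -> orthocomp (orthocomp S) = S.
Proof.
move=> [dec _]; apply/seteqP; split=> x; last first.
  by move=> Sx y Oy; apply: inner_eq0C; exact: Oy.
move=> OOx; have [y [z [Sy Oz E]]] := dec x; rewrite E.
suff -> : z = 0 by rewrite addr0.
apply: inner_def; have := OOx z Oz; rewrite E innerDr.
by rewrite (inner_eq0C (Oz y Sy)) add0r.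
Qed.

Lemma orthogonally_complementableC S : orthogonally_complementable S ->
  orthogonally_complementable (orthocomp S).
Proof.
move=> oS; case: (oS) => dec _; apply: orthogonally_complementable_exists.
  exact: orthocomp_submodule.
move=> x; have [y [z [Sy Oz ->]]] := dec x; exists z => //.
by rewrite addrK orthocompK.
Qed.

End Submodules.

End HilbertModules.
(** * The open mapping theorem *)

Section OpenMapping.
Context {R : realType} {A : cstarAlgType R} {M : hilbertModType A}.
Implicit Types (x y z l : M) (S : set M) (E : R -> set M).

Local Notation half := (2^-1 : R).

Lemma submodule_rscal S t x : submodule S -> S x -> S (rscal t x).
Proof. by move=> [_ _ SM]; exact: SM. Qed.

Lemma hilbert_limit (u : nat -> M) (K : R) :
  (forall k, rnorm (u k.+1 - u k) <= K * half ^+ k) ->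
  exists l, forall k, rnorm (l - u k) <= 2 * K * half ^+ k.
Proof.
move=> uK; have [||l lu] := geometric_limit (@hilbert_complete R A M) _ _ uK.
- by lra.
- by lra.
exists l => k; rewrite (le_trans (lu k)) //.
suff -> : K * half ^+ k / (1 - half) = 2 * K * half ^+ k by [].
by field.
Qed.

Lemma closed_limit S (u : nat -> M) l (C : R) : closed S -> (forall n, S (u n)) ->
  (forall n, rnorm (l - u n) <= C * half ^+ n) -> S l.
Proof.
move=> /closed_rnormP cS Su lu; apply: cS => e e0.
have C0 : 0 <= C by rewrite (le_trans (rnorm_ge0 _) (le_trans (lu 0%N) _)) // mulr1.
have [|||n hn] := @exprn_small R half (e / (C + 1)).
- by lra.
- by lra.
- by rewrite divr_gt0 // ltr_wpDl.
exists (u n) => //; rewrite (le_lt_trans (lu n)) //.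
rewrite ltr_pdivlMr ?ltr_wpDl // in hn.
by apply: le_lt_trans hn; rewrite mulrC ler_wpM2l ?exprn_ge0 // lerDl.
Qed.

(** Baire's category argument: were the differences of each E k nowhere close to
    filling a ball, every ball would contain a smaller ball missing E k (around
    its center or around a translate of it), and a limit of nested balls would
    belong to no E k. *)
Lemma baire_difference S (E : nat -> set M) : closed_submodule S ->
  (forall x, S x -> exists k, E k x) ->
  exists k (d : R), 0 < d /\ forall z, S z -> rnorm z <= d -> forall e : R, 0 < e ->
    exists x y, [/\ E k x, E k y & rnorm (z - (x - y)) < e].
Proof.
move=> [/submoduleP mS cS] cover; apply: contrapT => H.
have step k x (r : R) : exists p : M * R, S x -> 0 < r ->
    [/\ S p.1, 0 < p.2, p.2 <= r / 2, rnorm (p.1 - x) <= r / 2 &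
        forall y, E k y -> p.2 < rnorm (p.1 - y)].
  have [[Sx r0]|] := pselect (S x /\ 0 < r); last first.
    by move=> no; exists (x, r) => Sx r0; case: no.
  apply: contrapT => noy; apply: H; exists k, (r / 2); split.
    by rewrite divr_gt0.
  move=> z Sz zr e e0; apply: contrapT => far.
  (* One of x and x + z is at distance at least e / 2 from E k: two points of
     E k close to them would have a difference within e of z. *)
  pose p := Num.min (r / 2) (e / 4).
  have p0 : 0 < p by rewrite lt_min !divr_gt0.
  have pe : p < e / 2 by rewrite (@le_lt_trans _ _ (e / 4)) ?ge_min ?lexx ?orbT //; lra.
  have pr : p <= r / 2 by rewrite ge_min lexx.
  have near w : S w -> rnorm (w - x) <= r / 2 ->
      exists2 y, E k y & rnorm (w - y) < e / 2.
    move=> Sw wx; apply: contrapT => no; apply: noy; exists (w, p) => _ _.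
    split=> // y Ey; rewrite ltNge; apply/negP => wy; apply: no.
    by exists y => //; exact: le_lt_trans pe.
  have [y' Ey' xy'] : exists2 y, E k y & rnorm (x - y) < e / 2.
    by apply: near => //; rewrite subrr rnorm0 divr_ge0 // ltW.
  have Sxz : S (x + z) by case: mS => _ SD _; exact: SD.
  have [|y Ey xzy] := near _ Sxz; first by rewrite addrC addKr.
  apply: far; exists y, y'; split => //.
  have -> : z - (y - y') = (x + z - y) - (x - y').
    rewrite !opprB [x + z]addrC -!addrA; congr (_ + _).
    by rewrite [RHS]addrC -!addrA addNr addr0 addrC.
  by rewrite (le_lt_trans (rnormB _ _)) // [ltRHS]splitr ltrD.
have /choice[f Hf] : forall q : nat * (M * R), exists p : M * R, S q.2.1 -> 0 < q.2.2 ->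
    [/\ S p.1, 0 < p.2, p.2 <= q.2.2 / 2, rnorm (p.1 - q.2.1) <= q.2.2 / 2 &
        forall y, E q.1 y -> p.2 < rnorm (p.1 - y)].
  by case=> k [x r]; exact: step.
pose fix s n : M * R := if n is m.+1 then f (m, s m) else (0, 1).
have sP n : S (s n).1 /\ 0 < (s n).2.
  elim: n => [|n [Ss s0]]; first by split=> //; case: mS.
  by have [] := Hf (n, s n) Ss s0.
have sstep n : [/\ (s n.+1).2 <= (s n).2 / 2, rnorm ((s n.+1).1 - (s n).1) <= (s n).2 / 2 &
   forall y, E n y -> (s n.+1).2 < rnorm ((s n.+1).1 - y)].
  by have [Ss s0] := sP n; have [] := Hf (n, s n) Ss s0.
have srad n : (s n).2 <= half ^+ n.
  elim: n => [|n IH]; first by rewrite expr0.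
  by have [] := sstep n; rewrite exprS; lra.
have [l lS] : exists l, forall k, rnorm (l - (s k).1) <= 2 * half * half ^+ k.
  apply: (@hilbert_limit (fun n => (s n).1)) => n.
  by have [_ + _] := sstep n; have := srad n; lra.
have sdist k n : rnorm ((s (k + n)%N).1 - (s k).1) <= (s k).2 - (s (k + n)%N).2.
  elim: n => [|n IH]; first by rewrite addn0 !subrr rnorm0.
  rewrite addnS (le_trans (rnorm_triangle (s (k + n)%N).1 _ _)) //.
  by have [+ + _] := sstep (k + n)%N; lra.
have ldist k : rnorm (l - (s k).1) <= (s k).2.
  apply/ler_addgt0Pr => e e0.
  have [|||n hn] := @exprn_small R half e; [by lra|by lra|by []|].
  rewrite (le_trans (rnorm_triangle (s (k + n)%N).1 _ _)) //.
  have hk : half ^+ k <= 1 by rewrite exprn_ile1 //; lra.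
  have hn0 : 0 <= half ^+ n by rewrite exprn_ge0.
  have := lS (k + n)%N; have := sdist k n; have [_] := sP (k + n)%N.
  rewrite exprD; have : half ^+ k * half ^+ n <= half ^+ n by rewrite ler_piMl.
  by lra.
have Sl : S l.
  by apply: (closed_limit (u := fun n => (s n).1) cS _ lS) => n; case: (sP n).
have [k Ekl] := cover l Sl.
have [_ _ /(_ l Ekl)] := sstep k.
by rewrite rnormBC ltNge ldist.
Qed.

(** E r plays the role of the image of the ball of radius r under a bounded
    operator whose domain is complete: geometrically small terms of E add up in E.
    Working with the family of images covers, without a common type of domains,
    closed submodules, sums of two of them and tuples of scalars. *)
Definition sigma_convex E := forall (r C : R) (y : nat -> M) l, 0 < r ->
  (forall j, E (r * half ^+ j) (y j)) ->
  (forall n, rnorm (l - \sum_(j < n) y j) <= C * half ^+ n) -> E (2 * r) l.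

(** Successive approximation: a preimage up to half the norm, applied to the
    successive residuals, sums to an exact preimage. *)
Lemma sigma_convex_iteration S E (K : R) : sigma_convex E -> 0 < K ->
  (forall r z, 0 < r -> S z -> rnorm z <= r ->
    exists e, [/\ E (K * r) e, S (z - e) & rnorm (z - e) <= r / 2]) ->
  forall r z, 0 < r -> S z -> rnorm z <= r -> E (2 * (K * r)) z.
Proof.
move=> sE K0 app r z r0 Sz zr.
have h0 n : 0 < half ^+ n by rewrite exprn_gt0.
have /choice[f Hf] : forall q : nat * M, exists e, S q.2 -> rnorm q.2 <= r * half ^+ q.1 ->
    [/\ E (K * (r * half ^+ q.1)) e, S (q.2 - e) & rnorm (q.2 - e) <= r * half ^+ q.1 / 2].
  move=> [n x]; have [[Sx xr]|no] := pselect (S x /\ rnorm x <= r * half ^+ n).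
    have [|e He] := app (r * half ^+ n) x _ Sx xr; last by exists e.
    by rewrite mulr_gt0.
  by exists 0 => Sx xr; case: no.
pose fix s n : M := if n is m.+1 then s m - f (m, s m) else z.
have sP n : S (s n) /\ rnorm (s n) <= r * half ^+ n.
  elim: n => [|n [Ss sr]]; first by rewrite expr0 mulr1.
  have [_ ? ?] := Hf (n, s n) Ss sr; split => //.
  by rewrite exprSr mulrA.
apply: (sE (K * r) r (fun n => f (n, s n))); first by rewrite mulr_gt0.
  by move=> n; have [Ss sr] := sP n; have [+ _ _] := Hf (n, s n) Ss sr; rewrite mulrA.
move=> n; suff -> : z - \sum_(j < n) f (j : nat, s j) = s n by case: (sP n).
elim: n => [|n IH]; first by rewrite big_ord0 subr0.
by rewrite big_ord_recr /= opprD addrA IH.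
Qed.

(** Baire's argument gives approximate preimages on a small ball, rescaling gives
    them everywhere, and successive approximation makes them exact. *)
Lemma open_mapping S E : closed_submodule S -> sigma_convex E ->
  (forall r y, E r y -> S y) -> (forall y, S y -> exists r, E r y) ->
  (forall r s y, r <= s -> E r y -> E s y) ->
  (forall r s x y, E r x -> E s y -> E (r + s) (x - y)) ->
  (forall r t x, 0 < t -> E r x -> E (t * r) (rscal t x)) ->
  exists2 K : R, 0 < K & forall r z, 0 < r -> S z -> rnorm z <= r -> E (K * r) z.
Proof.
move=> csS sE ES cover mono EB EZ; have [/submoduleP mS cS] := csS.
have [|k [d [d0 Hd]]] := @baire_difference S (fun n => E n%:R) csS.
  move=> y Sy; have [r Er] := cover y Sy; exists (Num.truncn r).+1.
  by apply: mono Er; rewrite ltW // truncnS_gt.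
pose K := (k%:R + k%:R + 1) / d.
have K0 : 0 < K by rewrite divr_gt0 // ltr_wpDl // addr_ge0.
exists (2 * K); first by rewrite mulr_gt0.
move=> r z r0 Sz zr; rewrite -mulrA.
apply: (sigma_convex_iteration sE K0 _ r0 Sz zr) => {}r {}z {}r0 {}Sz {}zr.
have dr : 0 < d / r by rewrite divr_gt0.
have rd : 0 < r / d by rewrite divr_gt0.
have [||x [y [Ex Ey zxy]]] := Hd (rscal (d / r) z) _ _ (d / 2) (divr_gt0 d0 (ltr0Sn _ _)).
- exact: submodule_rscal.
- by rewrite rnorm_rscal ?(ltW dr) // mulrAC ler_pdivrMr // ler_wpM2l // ltW.
have Exy : E (r / d * (k%:R + k%:R)) (rscal (r / d) (x - y)) by apply: EZ => //; exact: EB.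
exists (rscal (r / d) (x - y)); split.
- apply: mono Exy.
  have -> : K * r = r / d * (k%:R + k%:R) + r / d by rewrite /K; field; rewrite gt_eqF.
  by rewrite lerDl ltW.
- by apply: submoduleB => //; exact: ES Exy.
- have -> : z - rscal (r / d) (x - y) = rscal (r / d) (rscal (d / r) z - (x - y)).
    rewrite [in RHS]rscalD rscalN rscalA mulrA divfK ?gt_eqF // divff ?gt_eqF //.
    by rewrite rscal1.
  rewrite rnorm_rscal ?(ltW rd) //.
  have -> : r / 2 = r / d * (d / 2) by field; rewrite gt_eqF.
  by rewrite ler_wpM2l ?(ltW rd) // ltW.
Qed.

End OpenMapping.
(** * The method of continuity *)

Section Additive.
Context {V W : zmodType} {L : V -> W}.
Context (LD : {morph L : x y / x + y}).

Lemma additive0 : L 0 = 0.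
Proof. by apply: (addrI (L 0)); rewrite -LD !addr0. Qed.

Lemma additiveB : {morph L : x y / x - y}.
Proof. by move=> x y; rewrite -[in RHS](subrK y x) [in RHS]LD addrK. Qed.

Lemma additive_sum (I : Type) (r : seq I) (f : I -> V) :
  L (\sum_(i <- r) f i) = \sum_(i <- r) L (f i).
Proof. exact: (big_morph _ LD additive0). Qed.

End Additive.

Section Surjectivity.
Context {R : realType} {A : cstarAlgType R} {M : hilbertModType A}.
Implicit Types (x y z l : M) (S : set M) (L U V : M -> M).

Local Notation half := (2^-1 : R).

Lemma rscal_sum (I : Type) (r : seq I) (f : I -> M) t :
  rscal t (\sum_(i <- r) f i) = \sum_(i <- r) rscal t (f i).
Proof. by apply: (big_morph _ (rscalD t)); exact: ract0l. Qed.

(** Solving U x = z in place of V x = z leaves the residual (U - V) x, of norm at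
    most half that of z. *)
Lemma onto_perturbation S U V (B c : R) : closed_submodule S -> 0 < c ->
  {morph V : x y / x + y} -> (forall x, S x -> S (V x)) ->
  (forall x, S x -> rnorm (V x) <= B * rnorm x) ->
  (forall z, S z -> exists2 x, S x & U x = z) ->
  (forall x, S x -> c * rnorm x <= rnorm (U x)) ->
  (forall x, S x -> rnorm (U x - V x) <= c / 2 * rnorm x) ->
  forall z, S z -> exists2 x, S x & V x = z.
Proof.
move=> [/submoduleP mS cS] c0 VD VS VB Uonto Uc UV z Sz.
pose E r y := exists x, [/\ S x, rnorm x <= r & y = V x].
suff [x [Sx _ ->]] : E (2 * (c^-1 * (rnorm z + 1))) z by exists x.
have cV0 : 0 < c^-1 by rewrite invr_gt0.
apply: (sigma_convex_iteration (S := S) (E := E)) => //; first last.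
- by rewrite lerDl.
- by rewrite ltr_wpDl // rnorm_ge0.
- move=> r y r0 Sy yr; have [x Sx Ux] := Uonto y Sy.
  have xr : rnorm x <= c^-1 * r.
    by rewrite mulrC ler_pdivlMr // mulrC (le_trans (Uc x Sx)) // Ux.
  exists (V x); split; first by exists x.
    by apply: submoduleB => //; exact: VS.
  rewrite -Ux (le_trans (UV x Sx)) //.
  have -> : r / 2 = c / 2 * (c^-1 * r) by field; rewrite gt_eqF.
  by rewrite ler_wpM2l // divr_ge0 // ltW.
- move=> r C y l r0 /choice[x Hx] ly.
  have [|k kx] := @hilbert_limit _ _ M (fun n => \sum_(j < n) x j) r.
    move=> n; rewrite big_ord_recr /= addrAC subrr add0r.
    by have [] := Hx n.
  have Sk : S k.
    apply: (closed_limit (u := fun n => \sum_(j < n) x j) cS _ kx) => n.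
    by apply: submodule_sum => // j; have [] := Hx j.
  exists k; split => //.
    by have := kx 0%N; rewrite big_ord0 subr0 expr0 mulr1.
  apply/eqP; rewrite -subr_eq0; apply/eqP.
  apply: (@geometric_rnorm_eq0 _ _ half (C + `|B| * (2 * r))); [by []|lra|] => n.
  have Vn : V (\sum_(j < n) x j) = \sum_(j < n) y j.
    by rewrite (additive_sum VD); apply: eq_bigr => j _; have [_ _ ->] := Hx j.
  rewrite (le_trans (rnorm_triangle (\sum_(j < n) y j) _ _)) // mulrDl lerD //.
  rewrite rnormBC -Vn -(additiveB VD).
  have Skn : S (k - \sum_(j < n) x j).
    by apply: submoduleB => //; apply: submodule_sum => // j; have [] := Hx j.
  rewrite (le_trans (VB _ Skn)) // -mulrA.
  rewrite (le_trans (ler_wpM2r (rnorm_ge0 _) (ler_norm B))) //.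
  by rewrite ler_wpM2l // kx.
Qed.

(** L + t is a small perturbation of t when t is large; from there surjectivity
    is carried down to t = 0 in steps of length c / 2. *)
Lemma onto_continuation S L (B c : R) : closed_submodule S -> 0 < c ->
  {morph L : x y / x + y} -> (forall x, S x -> S (L x)) ->
  (forall x, S x -> rnorm (L x) <= B * rnorm x) ->
  (forall (t : R) x, 0 <= t -> S x -> c * rnorm x <= rnorm (L x + rscal t x)) ->
  forall z, S z -> exists2 x, S x & L x = z.
Proof.
move=> csS c0 LD LS LB Lc; have [/submoduleP mS _] := csS.
pose V t x := L x + rscal t x.
have VD t : {morph V t : x y / x + y}.
  by move=> x y; rewrite /V LD rscalD addrACA.
have VS t x : S x -> S (V t x).
  by move=> Sx; case: (mS) => _ SD _; apply: SD; [exact: LS|exact: submodule_rscal].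
have VB t x : 0 <= t -> S x -> rnorm (V t x) <= (B + t) * rnorm x.
  by move=> t0 Sx; rewrite (le_trans (rnormD _ _)) // mulrDl rnorm_rscal // lerD2r LB.
pose onto t := forall z, S z -> exists2 x, S x & V t x = z.
have start : exists2 t, 0 <= t & onto t.
  pose t := 2 * `|B| + 1; have t0 : 0 < t by rewrite ltr_wpDl // mulr_ge0.
  exists t; first exact: ltW.
  apply: (onto_perturbation (U := rscal t) csS t0 (VD t) (VS t)) => [x|z Sz|x Sx|x Sx].
  - by apply: VB; exact: ltW.
  - exists (rscal t^-1 z); first exact: submodule_rscal.
    by rewrite rscalA divff ?gt_eqF // rscal1.
  - by rewrite rnorm_rscal // ltW.
  - rewrite /V [L x + _]addrC opprD addrA subrr add0r rnormN (le_trans (LB x Sx)) //.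
    rewrite ler_wpM2r ?rnorm_ge0 // /t (le_trans (ler_norm B)) //; lra.
have step t t' : 0 <= t' -> t' <= t -> t - t' <= c / 2 -> onto t -> onto t'.
  move=> t'0 t't tt' ot.
  apply: (onto_perturbation (U := V t) csS c0 (VD t') (VS t')) => // x Sx.
  - exact: VB.
  - by apply: Lc => //; exact: le_trans t't.
  - have -> : V t x - V t' x = rscal (t - t') x.
      by rewrite /V opprD addrACA subrr add0r -{1}(subrK t' t) rscalDt addrK.
    by rewrite rnorm_rscal ?subr_ge0 // ler_wpM2r // rnorm_ge0.
have [t t0 ot] := start.
have descent n : onto (Num.max 0 (t - c / 2 * n%:R)).
  elim: n => [|n]; first by rewrite mulr0 subr0 max_r.
  have mx : Num.max 0 (t - c / 2 * n.+1%:R) <= Num.max 0 (t - c / 2 * n%:R).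
    rewrite ge_max !le_max lexx /=; apply/orP; right.
    by rewrite lerD2l lerN2 ler_wpM2l ?ler_nat // divr_ge0 // ltW.
  apply: step => //; first by rewrite le_max lexx.
  rewrite lerBlDr ge_max; apply/andP; split.
    by rewrite addr_ge0 ?divr_ge0 ?(ltW c0) // le_max lexx.
  rewrite -lerBlDl le_max; apply/orP; right.
  by rewrite -(natr1 n) mulrDr mulr1; lra.
have [n nt] : exists n : nat, t <= c / 2 * n%:R.
  exists (Num.truncn (t / (c / 2))).+1.
  by rewrite -ler_pdivrMl ?divr_gt0 // mulrC ltW // truncnS_gt.
have := descent n; rewrite max_l ?subr_le0 // => o0 z Sz.
by have [x Sx <-] := o0 z Sz; exists x => //; rewrite /V rscal0t addr0.
Qed.

(** The positive element t <x, x> only increases the norm of <x, L x>, so that L + t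
    is bounded below by e / 3 for every t >= 0, by the Cauchy-Schwarz inequality. *)
Lemma coercive_onto S L (B e : R) : closed_submodule S -> 0 < e ->
  {morph L : x y / x + y} -> (forall x, S x -> S (L x)) ->
  (forall x, S x -> rnorm (L x) <= B * rnorm x) ->
  (forall x, S x -> exists a b, [/\ cstar_pos a, norm_pos b,
     inner x (L x) = a + b & e * rnorm x ^+ 2 <= rnorm a]) ->
  forall z, S z -> exists2 x, S x & L x = z.
Proof.
move=> csS e0 LD LS LB Le.
apply: (onto_continuation (c := e / 3) csS _ LD LS LB); first by rewrite divr_gt0.
move=> t x t0 Sx; have [a [b [pa pb E ea]]] := Le x Sx.
have [->|/eqP/rnorm_gt0 x0] := eqVneq x 0; first by rewrite rnorm0 mulr0 rnorm_ge0.
have tE : inner x (rscal t x) = inner (rscal (Num.sqrt t) x) (rscal (Num.sqrt t) x).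
  by rewrite inner_rscall !inner_rscalr scalerA -rmorphM -expr2 sqr_sqrtr.
have := rnorm_inner_le x (L x + rscal t x).
have := rnorm_le_add pa (norm_posD pb
  (cstar_pos_norm_pos (inner_pos (rscal (Num.sqrt t) x)))).
rewrite innerDr E tE addrA => /(le_trans ea) H1 /(le_trans H1).
by nra.
Qed.

End Surjectivity.
(** * Complements of ranges and direct sums *)

Section ClosedRange.
Context {R : realType} {A : cstarAlgType R}.

Lemma bounded_onP (M N : hilbertModType A) (S : set M) (F : M -> N) :
  bounded_on S F <->
  exists2 c : R, 0 < c & forall x, S x -> rnorm (F x) <= c * rnorm x.
Proof.
split=> [[c [c0 Fc]]|[c c0 Fc]].
  have cE : c = (rnorm c)%:C by rewrite -rnormE gtr0_norm.
  exists (rnorm c); first by rewrite -(ltcR 0) -cE.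
  by move=> x Sx; rewrite -lecR rmorphM /= -cE -!rnormE; exact: Fc.
exists c%:C; split; first by rewrite ltcR.
by move=> x Sx; rewrite !rnormE -rmorphM lecR; exact: Fc.
Qed.

Lemma bounded_below_onP (M N : hilbertModType A) (S : set M) (F : M -> N) :
  bounded_below_on S F <->
  exists2 c : R, 0 < c & forall x, S x -> c * rnorm x <= rnorm (F x).
Proof.
split=> [[c [c0 Fc]]|[c c0 Fc]].
  have cE : c = (rnorm c)%:C by rewrite -rnormE gtr0_norm.
  exists (rnorm c); first by rewrite -(ltcR 0) -cE.
  by move=> x Sx; rewrite -lecR rmorphM /= -cE -!rnormE; exact: Fc.
exists c%:C; split; first by rewrite ltcR.
by move=> x Sx; rewrite !rnormE -rmorphM lecR; exact: Fc.
Qed.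

Lemma norm_pos0 : norm_pos (0 : A).
Proof. by exists 0 => s s0; rewrite subr0 rnorm_scalar_le. Qed.

Lemma inner_ext (M : hilbertModType A) (x y : M) :
  (forall z, inner z x = inner z y) -> x = y.
Proof.
move=> xy; apply/eqP; rewrite -subr_eq0; apply/eqP; apply: inner_def.
by rewrite innerBr xy subrr.
Qed.

(** L = P G F, with P the orthogonal projection onto S and G the adjoint of F, is
    coercive on S because <x, L x> = <F x, F x>. *)
Lemma range_complement (M N : hilbertModType A) (F : {linear M -> N}) (S : set M) :
  bounded_adjointable F -> closed_submodule S -> orthogonally_complementable S ->
  bounded_below_on S F ->
  forall n, exists2 x, S x & orthocomp (F @` S) (n - F x).
Proof.
move=> [/bounded_onP[B B0 FB] [G FG]] csS [dec _] /bounded_below_onP[c c0 Fc] n.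
have [/submoduleP mS _] := csS.
have /choice[P HP] : forall x, exists y, S y /\ orthocomp S (x - y).
  by move=> x; have [y [z [Sy Oz ->]]] := dec x; exists y; rewrite addrAC subrr add0r.
have PS x : S (P x) by case: (HP x).
have PO x y : S y -> inner y (P x) = inner y x.
  move=> Sy; have [_ /(_ y Sy)] := HP x; rewrite innerBr => /eqP.
  by rewrite subr_eq0 => /eqP.
have PD : {morph P : x y / x + y}.
  move=> x y; apply/eqP; rewrite -subr_eq0; apply/eqP.
  have Sxy : S (P (x + y) - (P x + P y)).
    by apply: submoduleB => //; case: (mS) => _ SD _; exact: SD.
  apply: (orthocomp_meet Sxy) => z Sz.
  by rewrite innerBr innerDr !PO // innerDr subrr.
have Pn x : rnorm (P x) <= rnorm x.
  have := @rnorm_orthoD _ _ _ (P x) (x - P x); rewrite [P x + _]addrC subrK; apply.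
  by have [_ ] := HP x; apply.
have GD : {morph G : x y / x + y}.
  by move=> x y; apply: inner_ext => z; rewrite innerDr -!FG innerDr.
have GB y : rnorm (G y) <= 3 * B * rnorm y.
  have [->|/eqP/rnorm_gt0 g0] := eqVneq (G y) 0.
    by rewrite rnorm0 mulr_ge0 ?rnorm_ge0 // mulr_ge0 // ltW.
  have := rnorm_inner_le (F (G y)) y; rewrite FG rnorm_inner.
  have := FB (G y) I; have := rnorm_ge0 y; have := rnorm_ge0 (F (G y)).
  set p := rnorm (F _); set q := rnorm (G y) in g0 *; set r := rnorm y.
  move=> p0 r0 pq H; rewrite -(ler_pM2r g0) -expr2 (le_trans H) //.
  have := ler_wpM2r r0 pq; lra.
have [|||||x Sx Lx] := @coercive_onto _ _ M S (fun x => P (G (F x))) (3 * B * B) (c ^+ 2)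
    csS _ _ _ _ _ (P (G n)) (PS _).
- by rewrite exprn_gt0.
- by move=> x y; rewrite linearD GD PD.
- by move=> x _; exact: PS.
- move=> x _; rewrite (le_trans (Pn _)) // (le_trans (GB _)) // -[leRHS]mulrA.
  by rewrite ler_wpM2l ?FB // mulr_ge0 // ltW.
- move=> x Sx; exists (inner (F x) (F x)), 0; split.
  + exact: inner_pos.
  + exact: norm_pos0.
  + by rewrite PO // FG addr0.
  + by rewrite rnorm_inner -exprMn ler_pXn2r ?nnegrE ?mulr_ge0 ?rnorm_ge0 ?(ltW c0) // Fc.
exists x => // _ [y Sy <-].
by rewrite FG (additiveB GD) innerBr -(PO (G n)) // -(PO (G (F x))) // Lx subrr.
Qed.

(** The projections of a direct sum of closed submodules are bounded: this is the
    open mapping theorem for the addition map. *)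
Lemma direct_sum_bound (M : hilbertModType A) (S T : set M) :
  closed_submodule S -> closed_submodule T -> direct_sum S T ->
  exists2 K : R, 0 < K & forall u v, S u -> T v -> rnorm u <= K * rnorm (u + v).
Proof.
move=> [/submoduleP mS cS] [/submoduleP mT cT] [dec meet].
pose E (r : R) (y : M) :=
  exists u v, [/\ S u, T v, rnorm u <= r, rnorm v <= r & y = u + v].
have uniq u v u' v' : S u -> T v -> S u' -> T v' -> u + v = u' + v' -> u = u'.
  move=> Su Tv Su' Tv' /eqP; rewrite -subr_eq0 opprD addrACA addr_eq0 opprB => /eqP uv.
  apply/eqP; rewrite -subr_eq0; apply/eqP.
  have : (S `&` T) (u - u') by split; [|rewrite uv]; exact: submoduleB.
  by rewrite meet.
have [||||||| K K0 HK] := @open_mapping _ _ M setT E.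
- split; last exact: closedT.
  by apply/submoduleP; split.
- move=> r C y l r0 /choice[u /choice[v uv]] ly.
  have [|k ku] := @hilbert_limit _ _ M (fun n => \sum_(j < n) u j) r.
    by move=> n; rewrite big_ord_recr /= addrAC subrr add0r; have [] := uv n.
  have [|k' kv] := @hilbert_limit _ _ M (fun n => \sum_(j < n) v j) r.
    by move=> n; rewrite big_ord_recr /= addrAC subrr add0r; have [] := uv n.
  exists k, k'; split.
  + apply: (closed_limit cS _ ku) => n.
    by apply: submodule_sum => // j; have [] := uv j.
  + apply: (closed_limit cT _ kv) => n.
    by apply: submodule_sum => // j; have [] := uv j.
  + by have := ku 0%N; rewrite big_ord0 subr0 expr0 mulr1.
  + by have := kv 0%N; rewrite big_ord0 subr0 expr0 mulr1.
  + apply/eqP; rewrite -subr_eq0; apply/eqP.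
    apply: (@geometric_rnorm_eq0 _ _ 2^-1 (C + 2 * r + 2 * r)); [by []|lra|] => n.
    rewrite (le_trans (rnorm_triangle (\sum_(j < n) y j) _ _)) // -addrA mulrDl lerD //.
    have -> : \sum_(j < n) y j = \sum_(j < n) u j + \sum_(j < n) v j.
      by rewrite -big_split; apply: eq_bigr => j _; have [] := uv j.
    rewrite opprD addrACA (le_trans (rnormD _ _)) // mulrDl lerD //.
      by rewrite rnormBC.
    by rewrite rnormBC.
- by [].
- move=> y _; have [u [v [Su Tv ->]]] := dec y.
  by exists (Num.max (rnorm u) (rnorm v)), u, v; rewrite !le_max !lexx orbT.
- move=> r s y rs [u [v [Su Tv ur vr ->]]]; exists u, v.
  by split => //; exact: le_trans rs.
- move=> r s x y [u [v [Su Tv ur vr ->]]] [u' [v' [Su' Tv' ur' vr' ->]]].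
  exists (u - u'), (v - v'); split; [exact: submoduleB|exact: submoduleB| | |].
  + by rewrite (le_trans (rnormB _ _)) // lerD.
  + by rewrite (le_trans (rnormB _ _)) // lerD.
  + by rewrite opprD addrACA.
- move=> r t x t0 [u [v [Su Tv ur vr ->]]].
  exists (rscal t u), (rscal t v); split; [exact: submodule_rscal|exact: submodule_rscal| | |].
  + by rewrite rnorm_rscal ?ler_pM2l // ltW.
  + by rewrite rnorm_rscal ?ler_pM2l // ltW.
  + exact: rscalD.
exists K => // u v Su Tv.
have [uv0|/eqP/rnorm_gt0 uv0] := eqVneq (u + v) 0.
  have -> : u = 0.
    apply: (uniq u v 0 0) => //; [by case: mS|by case: mT|by rewrite addr0].
  by rewrite rnorm0 mulr_ge0 ?rnorm_ge0 // ltW.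
have [u' [v' [Su' Tv' u'K _ E']]] := HK _ _ uv0 I (lexx _).
by rewrite {1}(uniq _ _ _ _ Su Tv Su' Tv' E').
Qed.

End ClosedRange.
(** * Finitely generated closed submodules *)

Section FinitelyGenerated.
Context {R : realType} {A : cstarAlgType R} {M : hilbertModType A}.
Implicit Types (x y z : M) (S : set M).

Definition rank_one (g x : M) : M := ract g (inner g x).

Lemma rank_oneD g : {morph rank_one g : x y / x + y}.
Proof. by move=> x y; rewrite /rank_one innerDr ractDr. Qed.

Lemma inner_rank_one g x y : inner x (rank_one g y) = inner x g * inner g y.
Proof. exact: innerMr. Qed.

Lemma rank_one_selfadjoint g x y :
  inner x (rank_one g y) = inner (rank_one g x) y.
Proof. by rewrite inner_rank_one innerMl -innerC. Qed.

Lemma rnorm_rank_one g x : rnorm (rank_one g x) <= 3 * rnorm g ^+ 2 * rnorm x.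
Proof.
rewrite (le_trans (rnorm_ract _ _)) //.
have := rnorm_inner_le g x; have := rnorm_ge0 g => g0.
by move=> /(ler_wpM2l g0); rewrite expr2; lra.
Qed.

(** This recovers <g, x> from its image g <g, x>, since
    <x, g <g, x>> = <g, x>^* <g, x>. *)
Lemma rnorm_inner_rank_one g x :
  rnorm (inner g x) ^+ 2 <= 3 * rnorm x * rnorm (rank_one g x).
Proof.
by rewrite -rnorm_star_mul -innerC -inner_rank_one rnorm_inner_le.
Qed.

Lemma norm_pos_sum (I : Type) (r : seq I) (P : pred I) (f : I -> A) :
  (forall i, norm_pos (f i)) -> norm_pos (\sum_(i <- r | P i) f i).
Proof.
move=> Hf; elim/big_ind : _ => //; first exact: norm_pos0.
exact: norm_posD.
Qed.

(** The open mapping theorem for the map that sends the coefficients (a_i) to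
    the combination of the g_i. *)
Lemma generated_bound n (g : 'I_n -> M) S : closed_submodule S ->
  S = [set x | exists a : 'I_n -> A, x = \sum_(i < n) ract (g i) (a i)] ->
  exists2 K : R, 0 < K & forall x, S x -> exists2 a : 'I_n -> A,
    forall i, rnorm (a i) <= K * rnorm x & x = \sum_(i < n) ract (g i) (a i).
Proof.
move=> csS SE; have [/submoduleP mS cS] := csS.
pose E (r : R) y := exists2 a : 'I_n -> A,
  forall i, rnorm (a i) <= r & y = \sum_(i < n) ract (g i) (a i).
have [||||||K K0 HK] := @open_mapping _ _ M S E csS.
- move=> r C y l r0 Ey ly.
  have /choice[a Ha] : forall j, exists a : 'I_n -> A,
      (forall i, rnorm (a i) <= r * 2^-1 ^+ j) /\ y j = \sum_(i < n) ract (g i) (a i).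
    by move=> j; have [a ? ?] := Ey j; exists a.
  have /choice[b Hb] : forall i, exists b : A, forall k,
      rnorm (b - \sum_(j < k) a j i) <= 2 * r * 2^-1 ^+ k.
    move=> i; have [|||b Hb] := @geometric_limit _ A (fun k => \sum_(j < k) a j i) r 2^-1
      cstar_complete; [by []|lra| |].
      by move=> k; rewrite big_ord_recr /= addrAC subrr add0r; case: (Ha k).
    exists b => k; rewrite (le_trans (Hb k)) // le_eqVlt; apply/orP; left.
    by apply/eqP; field.
  exists b => [i|]; first by have := Hb i 0%N; rewrite big_ord0 subr0 expr0 mulr1.
  apply/eqP; rewrite -subr_eq0; apply/eqP.
  apply: (@geometric_rnorm_eq0 _ _ 2^-1 (C + \sum_(i < n) rnorm (g i) * (2 * r)));
    [by []|lra|] => k.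
  rewrite (le_trans (rnorm_triangle (\sum_(j < k) y j) _ _)) // mulrDl lerD //.
  have -> : \sum_(j < k) y j = \sum_(i < n) ract (g i) (\sum_(j < k) a j i).
    rewrite (eq_bigr (fun j : 'I_k => \sum_(i < n) ract (g i) (a j i))); last first.
      by move=> j _; case: (Ha j).
    rewrite exchange_big; apply: eq_bigr => i _.
    by rewrite (additive_sum (ractDr (g i))).
  rewrite rnormBC -sumrB (le_trans (rnorm_sum _ _)) // mulr_suml ler_sum // => i _.
  rewrite -(additiveB (ractDr (g i))) (le_trans (rnorm_ract _ _)) // -mulrA.
  by rewrite ler_wpM2l ?rnorm_ge0.
- by move=> r y [a _ ->]; rewrite SE; exists a.
- move=> y; rewrite {1}SE => -[a ->]; exists (\sum_i rnorm (a i)), a => // i.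
  by rewrite (bigD1 i) //= lerDl sumr_ge0 // => j _; exact: rnorm_ge0.
- by move=> r s y rs [a ar ->]; exists a => // i; exact: le_trans rs.
- move=> r s x y [a ar ->] [b bs ->]; exists (fun i => a i - b i).
    by move=> i; rewrite (le_trans (rnormB _ _)) // lerD.
  by rewrite -sumrB; apply: eq_bigr => i _; rewrite ractDr ractNr.
- move=> r t x t0 [a ar ->]; exists (fun i => t%:C *: a i).
    by move=> i; rewrite crnormZ rnorm_real ?ler_pM2l // ltW.
  rewrite rscal_sum; apply: eq_bigr => i _.
  by rewrite /rscal -ractM cscaleAr mulr1.
exists K => // x Sx.
have [x0|/eqP/rnorm_gt0 x0] := eqVneq x 0; last exact: HK.
exists (fun=> 0) => [i|]; first by rewrite x0 !rnorm0 mulr0.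
by rewrite x0 big1 // => i _; rewrite ract0.
Qed.

(** The sum L of the squares of the rank one operators is coercive on S: writing x
    with coefficients bounded by K |x|, the norm |x| ^ 2 of <x, x> is bounded by
    K |x| times the sum of the |<g_i, x>|, so some <g_i, x>, and then g_i <g_i, x>,
    is at least a fixed multiple of |x|. *)
Lemma finitely_generated_complementable S : closed_submodule S ->
  finitely_generated S -> orthogonally_complementable S.
Proof.
move=> csS [n [g SE]]; have [/submoduleP mS cS] := csS.
have gen (a : 'I_n -> A) : S (\sum_(i < n) ract (g i) (a i)) by rewrite SE; exists a.
have [K K0 HK] := generated_bound csS SE.
have theta_S i x : S (rank_one (g i) x).
  rewrite SE; exists (fun j => if j == i then inner (g i) x else 0).
  rewrite (bigD1 i) //= eqxx big1 ?addr0 // => j /negbTE ->.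
  by rewrite ract0.
pose L x := \sum_(i < n) rank_one (g i) (rank_one (g i) x).
have inner_L x : inner x (L x) =
    \sum_(i < n) inner (rank_one (g i) x) (rank_one (g i) x).
  by rewrite inner_sumr; apply: eq_bigr => i _; exact: rank_one_selfadjoint.
have LD : {morph L : x y / x + y}.
  by move=> x y; rewrite -big_split; apply: eq_bigr => i _; rewrite !rank_oneD.
have LS x : S (L x) by apply: submodule_sum.
pose B := \sum_(i < n) (3 * rnorm (g i) ^+ 2) * (3 * rnorm (g i) ^+ 2).
have LB x : rnorm (L x) <= B * rnorm x.
  rewrite (le_trans (rnorm_sum _ _)) // mulr_suml ler_sum // => i _.
  rewrite (le_trans (rnorm_rank_one _ _)) // -[leRHS]mulrA ler_wpM2l ?rnorm_rank_one //.
  by rewrite mulr_ge0 // exprn_ge0 // rnorm_ge0.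
(* With n + 1 in place of n, the n terms estimated below add up to strictly less
   than |x| ^ 2, and D is positive even if there is no generator. *)
pose D := K * n.+1%:R; have D0 : 0 < D by rewrite mulr_gt0.
pose c := (3 * D ^+ 2)^-1; have c0 : 0 < c by rewrite invr_gt0 mulr_gt0 // exprn_gt0.
have coercive x : S x -> 0 < rnorm x ->
    exists i, c * rnorm x <= rnorm (rank_one (g i) x).
  move=> Sx x0; have [a aK xE] := HK x Sx.
  have [i Hi] : exists i, rnorm x <= D * rnorm (inner (g i) x).
    apply: contrapT => no.
    have small i : rnorm (inner (g i) x) <= rnorm x / D.
      rewrite leNgt; apply/negP => H; apply: no; exists i.
      by move: H; rewrite ltr_pdivrMr // mulrC => /ltW.
    have : rnorm x ^+ 2 <= \sum_(i < n) rnorm x / D * (K * rnorm x).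
      rewrite -rnorm_inner {2}xE inner_sumr (le_trans (rnorm_sum _ _)) // ler_sum // => i _.
      rewrite innerMr (le_trans (crnormM _ _)) // ler_pM ?rnorm_ge0 //.
      by rewrite innerC rnorm_star.
    rewrite sumr_const card_ord -mulr_natr leNgt => /negP; apply.
    have -> : rnorm x / D * (K * rnorm x) * n%:R = rnorm x ^+ 2 * (n%:R / n.+1%:R).
      by rewrite /D; field; rewrite !gt_eqF //= ?andbT ltr_pwDl.
    by rewrite gtr_pMr ?exprn_gt0 // ltr_pdivrMr // mul1r ltr_nat.
  exists i; have := rnorm_inner_rank_one (g i) x.
  rewrite /c ler_pdivrMl ?mulr_gt0 ?exprn_gt0 //.
  set b := rnorm (inner _ _) in Hi *; set q := rnorm (rank_one _ _) => bq.
  rewrite -(ler_pM2l x0) -expr2 (@le_trans _ _ (D ^+ 2 * b ^+ 2)) //.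
    by rewrite -exprMn ler_pXn2r ?nnegrE ?mulr_ge0 ?rnorm_ge0 // ltW.
  by have := ler_wpM2l (ltW (exprn_gt0 2 D0)) bq; lra.
apply: orthogonally_complementable_exists => // x.
have [||||y Sy Ly] := @coercive_onto _ _ M S L B (c ^+ 2) csS _ LD _ _ _ (L x) (LS x).
- by rewrite exprn_gt0.
- by move=> y _; exact: LS.
- by move=> y _; exact: LB.
- move=> y Sy; have [->|/eqP/rnorm_gt0 y0] := eqVneq y 0.
    exists (inner 0 (0 : M)), 0; split; [exact: inner_pos|exact: norm_pos0| |].
      by rewrite !inner0l addr0.
    by rewrite inner0l !rnorm0 expr0n mulr0.
  have [i Hi] := coercive y Sy y0.
  exists (inner (rank_one (g i) y) (rank_one (g i) y)),
    (\sum_(j < n | j != i) inner (rank_one (g j) y) (rank_one (g j) y)); split.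
  + exact: inner_pos.
  + by apply: norm_pos_sum => j; exact/cstar_pos_norm_pos/inner_pos.
  + by rewrite inner_L (bigD1 i).
  + by rewrite rnorm_inner -exprMn ler_pXn2r ?nnegrE ?mulr_ge0 ?rnorm_ge0 // ltW.
exists y => //; set z := x - y.
have Lz : L z = 0 by rewrite /z additiveB // Ly subrr.
have gz i : inner (g i) z = 0.
  have : rank_one (g i) z = 0.
    apply: inner_def; apply: rnorm_eq0; apply/le_anti; rewrite rnorm_ge0 andbT.
    have := @rnorm_le_add _ _ _ (\sum_(j < n | j != i)
      inner (rank_one (g j) z) (rank_one (g j) z)) (inner_pos (rank_one (g i) z)).
    rewrite -[inner _ _ + _](bigD1 (P := xpredT) i) //= -inner_L Lz inner0r rnorm0.
    by apply; apply: norm_pos_sum => j; exact/cstar_pos_norm_pos/inner_pos.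
  move=> gz0; have := rnorm_inner_rank_one (g i) z; rewrite gz0 rnorm0 mulr0 => H.
  apply: rnorm_eq0; apply/eqP; rewrite -sqrf_eq0 eq_le H sqr_ge0 //.
rewrite /orthocomp /= => w; rewrite {1}SE => -[a ->].
apply: inner_eq0C; rewrite inner_sumr big1 // => i _.
by rewrite innerMr (inner_eq0C (gz i)) mul0r.
Qed.

End FinitelyGenerated.
(** * Upper semi-Fredholm operators *)

Section Fredholm.
Context {R : realType} {A : cstarAlgType R} {M N : hilbertModType A}.
Implicit Types (F : {linear M -> N}).

Lemma linear_ract F x a : F (ract x a) = ract (F x) a.
Proof. exact: (linearZ_LR F (a : A^c) x). Qed.

(** For x = u + v orthogonal to N1, with u in M1 and v in N1, x is the orthogonal
    projection of u, so |x| <= |u|; and F u is the component of F x in M2. *)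
Lemma bounded_below_of_iso F (M1 N1 : set M) (M2 N2 : set N) :
  closed_submodule M2 -> closed_submodule N2 ->
  direct_sum M1 N1 -> direct_sum M2 N2 ->
  F @` M1 `<=` M2 -> F @` N1 `<=` N2 -> restricts_to_iso F M1 M2 ->
  bounded_below_on (orthocomp N1) F.
Proof.
move=> cM2 cN2 [dec _] dN FM FN [_ _ [G /bounded_onP[c c0 Gc] GF]].
have [K K0 HK] := direct_sum_bound cM2 cN2 dN.
have cK : 0 < c * K by rewrite mulr_gt0.
apply/bounded_below_onP; exists (c * K)^-1; first by rewrite invr_gt0.
move=> x Ox; have [u [v [M1u N1v xE]]] := dec x.
have M2u : M2 (F u) by apply: FM; exists u.
have N2v : N2 (F v) by apply: FN; exists v.
have xu : rnorm x <= rnorm u.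
  have := @rnorm_orthoD _ _ _ x (- v); rewrite {3}xE addrK; apply.
  by rewrite innerNr (inner_eq0C (Ox v N1v)) oppr0.
rewrite ler_pdivrMl // (le_trans xu) // -{1}(GF u M1u) (le_trans (Gc _ M2u)) //.
by rewrite -mulrA ler_wpM2l ?(ltW c0) // xE linearD HK.
Qed.

(** N1 is the preimage of the orthogonal complement of F(S).  It is the graph of
    the map from the complement of S to S that removes the component of F x in
    F(S), which is why it complements S and is finitely generated. *)
Lemma upper_semi_Fredholm_of_bounded_below F (S : set M) :
  bounded_adjointable F -> closed_submodule S -> orthogonally_complementable S ->
  bounded_below_on S F -> finitely_generated (orthocomp S) ->
  upper_semi_Fredholm F.
Proof.
move=> bF csS oS bb [n [g gE]]; split => //.
have FR := range_complement bF csS oS bb.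
have [/bounded_onP[B B0 FB] _] := bF.
have /bounded_below_onP[c c0 Fc] := bb.
have [/submoduleP mS cS] := csS; case: (mS) => S0 SD SM.
pose M2 := F @` S; pose N2 := orthocomp M2; pose N1 := F @^-1` N2.
have mM2 : submodule M2.
  split; first by exists 0 => //; rewrite linear0.
  - by move=> _ _ [x Sx <-] [y Sy <-]; exists (x + y); [exact: SD|rewrite linearD].
  - by move=> _ a [x Sx <-]; exists (ract x a); [exact: SM|rewrite linear_ract].
have oM2 : orthogonally_complementable M2.
  apply: orthogonally_complementable_exists => // y; have [x Sx Fx] := FR y.
  by exists (F x) => //; exists x.
have [N20 N2D N2M] := orthocomp_submodule M2.
have mN1 : submodule N1.
  split; first by rewrite /N1 /= linear0.
  - by move=> x y N1x N1y; rewrite /N1 /= linearD; exact: N2D.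
  - by move=> x a N1x; rewrite /N1 /= linear_ract; exact: N2M.
have cN1 : closed N1.
  apply/closed_rnormP => x xN1.
  have /closed_rnormP := @orthocomp_closed _ _ _ M2; apply => e e0.
  have [y N1y xy] := xN1 _ (divr_gt0 e0 B0); exists (F y) => //.
  by rewrite -linearB (le_lt_trans (FB _ I)) // mulrC -ltr_pdivlMr.
have injS x : S x -> F x = 0 -> x = 0.
  move=> Sx Fx; apply: rnorm_eq0; apply/le_anti; rewrite rnorm_ge0 andbT.
  by have := Fc x Sx; rewrite Fx rnorm0 pmulr_rle0.
have meet x : S x -> N1 x -> x = 0.
  move=> Sx N1x; apply: injS => //; apply: (orthocomp_meet (S := M2)) => //.
  by exists x.
have dS : direct_sum S N1.
  split=> [x|].
    have [y Sy Ny] := FR (F x); exists y, (x - y); split => //; last by rewrite addrC subrK.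
    by rewrite /N1 /= linearB.
  apply/seteqP; split=> [x [Sx N1x]|x ->]; first exact: meet.
  by split=> //; case: mN1.
exists S, N1, M2, N2; split.
- by split=> //; split=> //; exact/submoduleP.
- split; last exact: orthocomp_closed_submodule.
  by rewrite -(orthocompK oM2); exact: orthocomp_closed_submodule.
- by split.
- by split=> // _ [x N1x <-].
- split.
    have /choice[J HJ] : forall y, exists x, M2 y -> S x /\ F x = y.
      move=> y; have [[x Sx <-]|no] := pselect (M2 y); first by exists x.
      by exists 0 => /no.
    have inj x y : S x -> S y -> F x = F y -> x = y.
      move=> Sx Sy Fxy; apply/eqP; rewrite -subr_eq0; apply/eqP; apply: injS.
        exact: submoduleB.
      by rewrite linearB /= Fxy subrr.
    split.
    + split=> [|x y|]; [by move=> x Sx; exists x| |by []].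
      by rewrite !inE; exact: inj.
    + by apply/bounded_onP; exists B => // x _; exact: FB.
    + exists J; last first.
        move=> x Sx; have [|SJ FJ] := HJ (F x); first by exists x.
        exact: inj.
      apply/bounded_onP; exists c^-1; first by rewrite invr_gt0.
      move=> y M2y; have [SJ FJ] := HJ y M2y.
      by rewrite mulrC ler_pdivlMr // mulrC -{2}FJ Fc.
  have /choice[h Hh] : forall i, exists h, S h /\ N1 (g i - h).
    move=> i; have [h Sh Nh] := FR (F (g i)); exists h; split => //.
    by rewrite /N1 /= linearB.
  have N1h (a : 'I_n -> A) : N1 (\sum_(i < n) ract (g i - h i) (a i)).
    apply: submodule_sum => // i; case: mN1 => _ _; apply.
    by have [] := Hh i.
  exists n, (fun i => g i - h i); apply/seteqP; split => [z N1z|_ [a ->]]; last exact: N1h.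
  have [dec _] := oS; have [y [w [Sy Ow zE]]] := dec z.
  move: Ow; rewrite gE => -[a wE]; exists a.
  apply/eqP; rewrite -subr_eq0; apply/eqP; apply: meet; last exact: (submoduleB mN1 N1z (N1h a)).
  have -> : \sum_(i < n) ract (g i - h i) (a i) = w - \sum_(i < n) ract (h i) (a i).
    by rewrite wE -sumrB; apply: eq_bigr => i _; rewrite ractDl ractNl.
  rewrite zE opprB -addrA [w + _]addrC subrK; apply: SD => //.
  by apply: submodule_sum => // i; apply: SM; have [] := Hh i.
Qed.

End Fredholm.

Theorem lemma3p1 (R : realType) (A : cstarAlgType R) (M N : hilbertModType A)
    (F : {linear M -> N}) (hF : bounded_adjointable F) :
  upper_semi_Fredholm F <->
  exists M' : set M,
    [/\ closed_submodule M', orthogonally_complementable M',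
        bounded_below_on M' F & finitely_generated (orthocomp M')].
Proof.
split=> [[_ [M1 [N1 [M2 [N2 [[_ cN1] [cM2 cN2] [dM dN] [FM FN] [iso fgN1]]]]]]]|].
  have oN1 := finitely_generated_complementable cN1 fgN1.
  exists (orthocomp N1); split; first exact: orthocomp_closed_submodule.
  - exact: orthogonally_complementableC.
  - exact: bounded_below_of_iso dM dN FM FN iso.
  - by rewrite orthocompK.
move=> [S [csS oS bb fg]].
exact: upper_semi_Fredholm_of_bounded_below oS bb fg.
Qed.
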